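(* Let $d,n\in\mathbb{N}_{\geq1}$, $s\in\mathbb{N}_{\geq0}$, $0<\lambda\leq1$, $\gamma:=s+\lambda$. For any $0<\epsilon<1$ and any $\boldsymbol{f}:[0,1]^{d\times n}\to\mathbb{R}^{d\times n}$ whose components $f_{pq}$ all belong to $C^{s,\lambda}([0,1]^{d\times n})$, there exists a Transformer $\boldsymbol{T}:\mathbb{R}^{d\times n}\to\mathbb{R}^{d\times n}$ of length $n$ with size \begin{align*} &L_0=4,\quad W_0=\mathcal{O}(\epsilon^{-1/\gamma});\\ &H_1=(3d+1)3^{dn}\binom{s+dn-1}{dn-1},\quad S_1=\max\{dn,3\};\\ &L_l=3,\quad W_l=d3^{dn}\binom{s+dn-1}{dn-1}(4n+11),\quad l=1,\dots,n-1;\\ &H_l=d3^{dn+1}\binom{s+dn-1}{dn-1},\quad S_l=3,\quad l=2,\dots,n;\\ &L_n=\mathcal{O}(\log\tfrac{1}{\epsilon}),\quad W_n=\mathcal{O}(\epsilon^{-dn/\gamma}) \end{align*} and dimension vector $\big(d,\ d+n+1+3^n,\ (2dn+5d)3^{dn}\binom{s+dn-1}{dn-1}\boldsymbol 1_{1\times n},\ d\big)$ such that for all $p\in[d],q\in[n]$, $$\|T_{pq}-f_{pq}\|_{L^\infty([0,1]^{d\times n})}\leq\epsilon.$$ Furthermore, the weight bounds of $\boldsymbol T$ are $B_{EB}=\mathcal{O}(1)$, $B_{FF}=\mathcal{O}(\epsilon^{-\max\{(6dn+2)/\gamma,1/\lambda\}})$, $B_{SA}=\mathcal{O}(\log\frac1\epsilon)$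 and its numbers of parameters are $M_{EB}=\mathcal{O}(1)$, $M_{FF}=\mathcal{O}(\epsilon^{-dn/\gamma})$, $M_{SA}=\mathcal{O}(1)$, where all $\mathcal{O}(\cdot)$ constants are independent of $\epsilon$.
   Context: Hölder space: for $\Omega\subset\mathbb{R}^D$, multi-indices $\boldsymbol{\mu}\in\mathbb{N}_{\geq0}^D$, $|\boldsymbol{\mu}|=\sum\mu_i$, $D^{\boldsymbol\mu}f$ the partial derivative; $\|f\|_{C^{s,\lambda}(\Omega)}:=\max\{\max_{|\boldsymbol\mu|\le s}\sup_{\Omega}|D^{\boldsymbol\mu}f|,\ \max_{|\boldsymbol\mu|=s}\sup_{x\neq y\in\Omega}|D^{\boldsymbol\mu}f(x)-D^{\boldsymbol\mu}f(y)|/\|x-y\|_2^\lambda\}$, and $C^{s,\lambda}(\Omega)$ is the set of functions with finite norm ($[0,1]^{d\times n}$ identified with $[0,1]^{dn}$). $[m]=\{1,\dots,m\}$. Transformers: $\sigma_R(x)=\max\{x,0\}$ entrywise; $\sigma_S$ is the column-wise softmax, $[\sigma_S(\boldsymbol x)]_i=e^{x_i}/\sum_{j=1}^n e^{x_j}$ applied to each column. A ReLU FNN $f:\mathbb{R}^a\to\mathbb{R}^b$ of depth $L$ and width $W$: $f_0=x$, $f_l=\sigma_R(W_lf_{l-1}+b_l)$ for $1\le l\le L-1$, $f=W_Lf_{L-1}+b_L$, with $W_1\in\mathbb{R}^{W\times a}$, $W_l\in\mathbb{R}^{W\times W}$, $W_L\in\mathbb{R}^{b\times W}$. The feedforward block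 generated by $f$ applies $f$ to each column of a matrix in $\mathbb{R}^{a\times n}$. A self-attention layer $\mathcal F_{SA}:\mathbb{R}^{D\times n}\to\mathbb{R}^{D\times n}$ with head number $H$, head size $S$: $\mathcal F_{SA}(X)=X+\sum_{h=1}^H W_O^{(h)}W_V^{(h)}X\sigma_S(X^\top W_K^{(h)\top}W_Q^{(h)}X)$, $W_O^{(h)}\in\mathbb{R}^{D\times S}$, $W_V^{(h)},W_K^{(h)},W_Q^{(h)}\in\mathbb{R}^{S\times D}$. An embedding layer is $\mathcal F_{EB}(X)=W_{EB}X+B_{EB}$. A Transformer of length $K$ is $\mathcal F_{FF}^{(K)}\circ\mathcal F_{SA}^{(K)}\circ\cdots\circ\mathcal F_{FF}^{(1)}\circ\mathcal F_{SA}^{(1)}\circ\mathcal F_{FF}^{(0)}\circ\mathcal F_{EB}$ with $\mathcal F_{EB}:\mathbb{R}^{d_{in}\times n}\to\mathbb{R}^{d_0\times n}$, $\mathcal F_{FF}^{(k)}:\mathbb{R}^{d_k\times n}\to\mathbb{R}^{d_{k+1}\times n}$ ($d_{K+1}:=d_{out}$), $\mathcal F_{SA}^{(k)}$ acting on $\mathbb{R}^{d_k\times n}$. Its size is $\{(L_0,W_0),(H_1,S_1),(L_1,W_1),\dots,(H_K,S_K),(L_K,W_K)\}$ (depths/widths of feedforward blocks, head numbers/sizes of attention layers); its dimension vector is $(d_{in},d_0,\dots,d_K,d_{out})$. $B_{EB},B_{FF},B_{SA}$ bound the absolute values of the parameters of the embedding layer, all feedforward blocks, all self-attention layers; $M_{EB},M_{FF},M_{SA}$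 are the corresponding numbers of parameters. *)

(* Defs.v *)
From HB Require Import structures.
From mathcomp Require Import all_boot all_order all_algebra.
From mathcomp Require Import reals sequences exp.
Set Implicit Arguments. Unset Strict Implicit. Unset Printing Implicit Defensive.
Import Order.TTheory GRing.Theory Num.Theory.
Local Open Scope ring_scope.

Section Transformers.
Variable R : realType.

Definition nnz m p (A : 'M[R]_(m, p)) : nat :=
  #|[set ij : 'I_m * 'I_p | A ij.1 ij.2 != 0]|.
Definition mx_bnd m p (A : 'M[R]_(m, p)) (B : R) : Prop :=
  forall i j, `|A i j| <= B.

Definition reluM m p (A : 'M[R]_(m, p)) : 'M[R]_(m, p) :=
  map_mx (fun x => Num.max x 0) A.
Definition softmaxC m p (A : 'M[R]_(m, p)) : 'M[R]_(m, p) :=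
  \matrix_(i, j) (expR (A i j) / \sum_(k < m) expR (A k j)).

(* depth L = size fhid + 2 :  W_1 in R^{W x a}, (L-2) hidden W x W layers,
   W_L in R^{b x W}; the depth is therefore always >= 2.                  *)
Record fnn (a b W : nat) := FNN {
  fW1 : 'M[R]_(W, a); fb1 : 'cV[R]_W;
  fhid : seq ('M[R]_(W, W) * 'cV[R]_W);
  fWL : 'M[R]_(b, W); fbL : 'cV[R]_b }.

Definition fnn_depth a b W (f : fnn a b W) : nat := (size (fhid f)).+2.

Definition fnn_eval a b W (f : fnn a b W) (x : 'cV[R]_a) : 'cV[R]_b :=
  let h1 := reluM (fW1 f *m x + fb1 f) in
  let h := foldl (fun h (l : 'M[R]_(W, W) * 'cV[R]_W) => reluM (l.1 *m h + l.2))
                 h1 (fhid f) in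
  fWL f *m h + fbL f.

Definition ff_block a b W (f : fnn a b W) n (X : 'M[R]_(a, n)) : 'M[R]_(b, n) :=
  \matrix_(i, j) (fnn_eval f (col j X)) i 0.

Definition fnn_nparams a b W (f : fnn a b W) : nat :=
  nnz (fW1 f) + nnz (fb1 f)
  + \sum_(l <- fhid f) (nnz l.1 + nnz l.2) + nnz (fWL f) + nnz (fbL f).

Definition fnn_bnd a b W (f : fnn a b W) (B : R) : Prop :=
  mx_bnd (fW1 f) B /\ mx_bnd (fb1 f) B /\
  (forall l, l \in fhid f -> mx_bnd l.1 B /\ mx_bnd l.2 B) /\
  mx_bnd (fWL f) B /\ mx_bnd (fbL f) B.

Record sa_layer (D S H : nat) := SAL {
  WO : 'I_H -> 'M[R]_(D, S);
  WV : 'I_H -> 'M[R]_(S, D);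
  WK : 'I_H -> 'M[R]_(S, D);
  WQ : 'I_H -> 'M[R]_(S, D) }.

Definition sa_apply D S H (L : sa_layer D S H) n (X : 'M[R]_(D, n)) : 'M[R]_(D, n) :=
  X + \sum_(h < H) (WO L h *m WV L h *m X
                      *m softmaxC (X^T *m (WK L h)^T *m WQ L h *m X)).

Definition sa_nparams D S H (L : sa_layer D S H) : nat :=
  \sum_(h < H) (nnz (WO L h) + nnz (WV L h) + nnz (WK L h) + nnz (WQ L h)).

Definition sa_bnd D S H (L : sa_layer D S H) (B : R) : Prop :=
  forall h, mx_bnd (WO L h) B /\ mx_bnd (WV L h) B /\
            mx_bnd (WK L h) B /\ mx_bnd (WQ L h) B.

(* Dimension vector (din, D 0, ..., D K, dout);
   FF^(k) : R^{D k x n} -> R^{D (k+1) x n} of width Wd k for k < K,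
   FF^(K) = ff_last : R^{D K x n} -> R^{dout x n} of width Wd K,
   SA^(k) on R^{D k x n} with Hd k heads of size Sd k (1 <= k <= K).
   Components of [ff k] for k >= K and [sa k] for k = 0 or k > K are unused. *)
Record transformer (n din dout K : nat) (D Wd Sd Hd : nat -> nat) := TF {
  tWEB : 'M[R]_(D 0, din);
  tBEB : 'M[R]_(D 0, n);
  tff : forall k, fnn (D k) (D k.+1) (Wd k);
  tff_last : fnn (D K) dout (Wd K);
  tsa : forall k, sa_layer (D k) (Sd k) (Hd k) }.

Section TFEval.
Variables (n din dout K : nat) (D Wd Sd Hd : nat -> nat).
Variable T : transformer n din dout K D Wd Sd Hd.

Definition tf_pre k (X : 'M[R]_(D k, n)) : 'M[R]_(D k, n) :=
  if k is 0 then X else sa_apply (tsa T k) X.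

Fixpoint tf_run (X : 'M[R]_(din, n)) (k : nat) : 'M[R]_(D k, n) :=
  match k with
  | 0 => tWEB T *m X + tBEB T
  | k'.+1 => ff_block (tff T k') (tf_pre (tf_run X k'))
  end.

Definition tf_eval (X : 'M[R]_(din, n)) : 'M[R]_(dout, n) :=
  ff_block (tff_last T) (tf_pre (tf_run X K)).

Definition tf_depth k : nat :=
  if (k < K)%N then fnn_depth (tff T k) else fnn_depth (tff_last T).

Definition tf_bnd_EB (B : R) : Prop := mx_bnd (tWEB T) B /\ mx_bnd (tBEB T) B.
Definition tf_bnd_FF (B : R) : Prop :=
  (forall k, (k < K)%N -> fnn_bnd (tff T k) B) /\ fnn_bnd (tff_last T) B.
Definition tf_bnd_SA (B : R) : Prop :=
  forall k, (1 <= k <= K)%N -> sa_bnd (tsa T k) B.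

Definition tf_M_EB : nat := nnz (tWEB T) + nnz (tBEB T).
Definition tf_M_FF : nat :=
  \sum_(k < K) fnn_nparams (tff T k) + fnn_nparams (tff_last T).
Definition tf_M_SA : nat := \sum_(1 <= k < K.+1) sa_nparams (tsa T k).
End TFEval.

Definition cube d n (x : 'M[R]_(d, n)) : Prop := forall i j, 0 <= x i j <= 1.

Definition eucl d n (x y : 'M[R]_(d, n)) : R :=
  Num.sqrt (\sum_(i < d) \sum_(j < n) (x i j - y i j) ^+ 2).

Definition mi_size d n (mu : {ffun 'I_d * 'I_n -> nat}) : nat := \sum_ij mu ij.
Definition mi_inc d n (mu : {ffun 'I_d * 'I_n -> nat}) (ij : 'I_d * 'I_n) :
  {ffun 'I_d * 'I_n -> nat} := [ffun kl => mu kl + (kl == ij)].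

(* g' is the partial derivative of g in the coordinate ij at every point of
   the cube (limit taken within the cube, i.e. one-sided on the boundary) *)
Definition partial_on_cube d n (g : 'M[R]_(d, n) -> R) (ij : 'I_d * 'I_n)
    (g' : 'M[R]_(d, n) -> R) : Prop :=
  forall x, cube x -> forall e : R, 0 < e -> exists2 del : R, 0 < del &
    forall t : R, t != 0 -> `|t| < del -> cube (x + t *: delta_mx ij.1 ij.2) ->
      `| (g (x + t *: delta_mx ij.1 ij.2) - g x) / t - g' x | <= e.

Definition holder d n (s : nat) (lam : R) (f : 'M[R]_(d, n) -> R) : Prop :=
  exists Dmu : {ffun 'I_d * 'I_n -> nat} -> 'M[R]_(d, n) -> R,
    [/\ forall x, cube x -> Dmu [ffun=> 0%N] x = f x,
        forall mu ij, (mi_size mu < s)%N -> partial_on_cube (Dmu mu) ij (Dmu (mi_inc mu ij)),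
        exists C : R, forall mu x, (mi_size mu <= s)%N -> cube x -> `|Dmu mu x| <= C
      & exists C : R, forall mu x y, mi_size mu = s -> cube x -> cube y -> x != y ->
          `|Dmu mu x - Dmu mu y| <= C * (eucl x y) `^ lam].

End Transformers.

Definition binom_sdn (d n s : nat) : nat := 'C(s + d * n - 1, d * n - 1).

Definition thm_dims (d n s : nat) (k : nat) : nat :=
  if k == 0 then (d + n + 1 + 3 ^ n)%N
  else ((2 * d * n + 5 * d) * 3 ^ (d * n) * binom_sdn d n s)%N.

(* Main.v *)
(* One attention head with zero query and key matrices averages the tokens
   exactly, so after the first feedforward block has moved column [j] of the
   input to a slot of its own (via [relu (x + onehot - 1)], exact on [0, 1]),
   every token holds the whole input together with its one-hot position.  All
   remaining layers but the last block are the identity.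

   The last block approximates a Holder function on [0, 1]^m, m = d n, with
   O(eps^(-m/gamma)) parameters.  Two staircases per coordinate, shifted by half
   a period, locate the cell of the input in each of 2^m grids of mesh 1/K; a
   product of cutoffs, forming a partition of unity, vanishes where a staircase
   jumps.  The K^m cells are numbered by an affine function of the staircases,
   and a piecewise linear function of this single number returns a Taylor
   coefficient of the cell.  The monomials are multiplied out by O(log 1/eps)
   layers of constant size, using the sawtooth approximation of the square. *)
Require Import Defs.
From HB Require Import structures.
From mathcomp Require Import all_boot all_order all_algebra.
From mathcomp Require Import reals sequences exp.
From mathcomp Require Import boolp classical_sets topology normedtype derive.
From mathcomp Require Import ring lra zify.
Set Implicit Arguments. Unset Strict Implicit. Unset Printing Implicit Defensive.
Import Order.TTheory GRing.Theory Num.Theory.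
Import numFieldNormedType.Exports.
Local Open Scope ring_scope.

(** * Matrices indexed by finite types *)


Section Embedding.
Variable R : realType.

(** A ReLU network is continuous, so every staircase is wrong near its jumps, where the tabulated
    value is just some number in [0, 1]. This is harmless because a cutoff that is exactly 0 there
    enters the same product. The approximate products need all factors in the unit interval; hence
    coefficients are split by sign and scaled before being tabulated, and sign and scale return in
    the output weights. A feedforward block applies one network to all columns, so the output column
    must be selected by the data: the one-hot position is a factor of every product. Parameter
    counts are linear, not quadratic, in the number of cells because a narrow layer, with one cell
    code per grid, separates the wide ones. Derivatives are one-sided on the boundary of the cube,
    so the local polynomials come from one-variable expansions along the coordinates, obtained by
    the mean value theorem on closed intervals. Widths and dimensions being prescribed, features are
    indexed by finite types and padded with zeros. *)

Definition emb (A : finType) W (v : A -> R) : 'cV[R]_W :=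
  \col_i \sum_(a | enum_rank a == i :> nat) v a.

Definition embM (A B : finType) W W' (w : B -> A -> R) : 'M[R]_(W', W) :=
  \matrix_(i, j) \sum_(b | enum_rank b == i :> nat)
                 \sum_(a | enum_rank a == j :> nat) w b a.

Lemma sum_enum_rank (A : finType) (v : A -> R) (i : nat) (a : A) :
  enum_rank a = i :> nat -> \sum_(a' | enum_rank a' == i :> nat) v a' = v a.
Proof.
move=> <-; rewrite (big_pred1 a) // => a'; rewrite -[RHS](inj_eq enum_rank_inj).
by [].
Qed.

Lemma sum_enum_rank0 (A : finType) (v : A -> R) (i : nat) :
  (#|A| <= i)%N -> \sum_(a | enum_rank a == i :> nat) v a = 0.
Proof.
move=> h; rewrite big_pred0 // => a; apply/negbTE.
by rewrite neq_ltn (leq_trans (ltn_ord _)).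
Qed.

(** The sum has at most one term: it is a total lookup, uniform in [v], that returns 0 on padding
    coordinates. As ReLU fixes 0, padding stays invisible. *)
Lemma sum_enum_rankP (A : finType) (i : nat) :
  (exists2 a : A, enum_rank a = i :> nat &
     forall v : A -> R, \sum_(a | enum_rank a == i :> nat) v a = v a) \/
  (forall v : A -> R, \sum_(a | enum_rank a == i :> nat) v a = 0).
Proof.
case: (ltnP i #|A|) => h; last by right=> v; exact: sum_enum_rank0.
left; exists (enum_val (Ordinal h)); first by rewrite enum_valK.
by move=> v; apply: sum_enum_rank; rewrite enum_valK.
Qed.

Lemma emb_ord m (v : 'I_m -> R) (i : 'I_m) : emb m v i 0 = v i.
Proof. by rewrite mxE; apply: sum_enum_rank; rewrite enum_rank_ord. Qed.

Lemma reluM_emb (A : finType) W (v : A -> R) :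
  reluM (emb W v) = emb W (fun a => Num.max (v a) 0).
Proof.
apply/matrixP => i j; rewrite !mxE.
by case: (@sum_enum_rankP A i) => [[a _ h]|h]; rewrite !h ?maxxx.
Qed.

Lemma embD (A : finType) W (v v' : A -> R) :
  emb W v + emb W v' = emb W (fun a => v a + v' a).
Proof. by apply/matrixP => i j; rewrite !mxE big_split. Qed.

Lemma emb_sum (A I : finType) W (v : I -> A -> R) :
  \sum_i emb W (v i) = emb W (fun a => \sum_i v i a).
Proof.
by apply/matrixP => i j; rewrite summxE !mxE exchange_big; apply: eq_bigr => k _; rewrite mxE.
Qed.

Lemma embZ (A : finType) W (c : R) (v : A -> R) :
  c *: emb W v = emb W (fun a => c * v a).
Proof. by apply/matrixP => i j; rewrite !mxE big_distrr. Qed.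

Lemma embM_mul (A B : finType) W W' (w : B -> A -> R) (v : A -> R) :
  (#|A| <= W)%N -> embM W W' w *m emb W v = emb W' (fun b => \sum_a w b a * v a).
Proof.
move=> hA; apply/matrixP => i j; rewrite !mxE.
case: (@sum_enum_rankP B i) => [[b _ h]|h]; last first.
  by rewrite h big1 // => k _; rewrite mxE h mul0r.
rewrite h (eq_bigr (fun j : 'I_W => \sum_(a | enum_rank a == j :> nat) w b a * v a)).
  rewrite (exchange_big_dep xpredT) //=; apply: eq_bigr => a _.
  rewrite (big_pred1 (Ordinal (leq_trans (ltn_ord (enum_rank a)) hA))) //.
move=> k _; rewrite !mxE h.
by case: (@sum_enum_rankP A k) => [[a _ h']|h']; rewrite !h' ?mulr0.
Qed.

Lemma embM_bnd (A B : finType) W W' (w : B -> A -> R) M :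
  0 <= M -> (forall b a, `|w b a| <= M) -> mx_bnd (embM W W' w) M.
Proof.
move=> M0 h i j; rewrite mxE.
case: (@sum_enum_rankP B i) => [[b _ ->]|->]; last by rewrite normr0.
by case: (@sum_enum_rankP A j) => [[a _ ->]|->]; rewrite ?normr0.
Qed.

Lemma emb_bnd (A : finType) W (v : A -> R) M :
  0 <= M -> (forall a, `|v a| <= M) -> mx_bnd (emb W v) M.
Proof.
move=> M0 h i j; rewrite mxE.
by case: (@sum_enum_rankP A i) => [[a _ ->]|->]; rewrite ?normr0.
Qed.

(** Counts nonzero entries through the indices that produce them, so that padding costs nothing: [g]
    is a partial map from [J] reaching every [k] in [P], and a choice of preimages is injective. *)
Lemma card_im_supp (J K : finType) (g : J -> K -> bool) (P : pred K) :
  (forall k, P k -> exists j, g j k) ->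
  (forall j k k', g j k -> g j k' -> k = k') ->
  (#|[set k | P k]| <= #|J|)%N.
Proof.
move=> h inj.
have /fin_all_exists[f hf] : forall k : {k | P k}, exists j, g j (val k).
  by case=> k Pk; apply: h.
have -> : #|[set k | P k]| = #|{: {k | P k}}| by rewrite card_sig cardsE.
apply: (leq_card f) => k k' e; apply/val_inj/(inj (f k)) => //=.
by rewrite e.
Qed.

Lemma nnz_embM (A B : finType) W W' (w : B -> A -> R) :
  (nnz (embM W W' w) <= #|B| * #|A|)%N.
Proof.
rewrite -card_prod.
apply: (@card_im_supp (B * A)%type _ (fun (ba : B * A) (ij : 'I_W' * 'I_W) => (enum_rank ba.1 == ij.1 :> nat) &&
                                        (enum_rank ba.2 == ij.2 :> nat)) (fun ij => embM W W' w ij.1 ij.2 != 0)).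
- move=> [i j]; rewrite mxE /=.
  case: (@sum_enum_rankP B i) => [[b hb ->]|->]; last by rewrite eqxx.
  case: (@sum_enum_rankP A j) => [[a ha ->]|->]; last by rewrite eqxx.
  by move=> _; exists (b, a); rewrite /= hb ha !eqxx.
- move=> [b a] [i j] [i' j'] /= /andP[/eqP h1 /eqP h2] /andP[/eqP h3 /eqP h4].
  by congr pair; apply/val_inj; rewrite /= -?h1 -?h2.
Qed.

Lemma nnz_emb (A : finType) W (v : A -> R) : (nnz (emb W v) <= #|A|)%N.
Proof.
apply: (@card_im_supp A _ (fun (a : A) (ij : 'I_W * 'I_1) => enum_rank a == ij.1 :> nat)
  (fun ij => emb W v ij.1 ij.2 != 0)).
- move=> [i j]; rewrite mxE /=.
  case: (@sum_enum_rankP A i) => [[a ha ->]|->]; last by rewrite eqxx.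
  by move=> _; exists a; rewrite ha.
- move=> a [i j] [i' j'] /= /eqP h1 /eqP h2.
  by congr pair; [apply/val_inj; rewrite /= -?h1 -?h2 | rewrite !ord1].
Qed.

Lemma nnz_le m p (A : 'M[R]_(m, p)) : (nnz A <= m * p)%N.
Proof. by rewrite /nnz (leq_trans (max_card _)) // card_prod !card_ord. Qed.

End Embedding.

(** * ReLU layers between finite families of features *)


Section Nets.
Variables (R : realType) (Y : Type) (dom : Y -> Prop).

(* Throughout, a hidden state is a family [F y : A -> R] of features indexed by
   a finite type and depending on a ghost parameter [y] (the network input). *)
Definition affine_in (A : finType) (F : Y -> A -> R) (M : R) (g : Y -> R) : Prop :=
  exists w : A -> R, exists b : R,
    [/\ forall a, `|w a| <= M, `|b| <= M &
        forall y, dom y -> g y = \sum_a w a * F y a + b].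

Lemma affine_in_mono (A : finType) (F : Y -> A -> R) M M' g :
  M <= M' -> affine_in F M g -> affine_in F M' g.
Proof.
move=> h [w [b [hw hb hg]]]; exists w, b; split=> // [a|]; exact: le_trans h.
Qed.

Lemma affine_in_eq (A : finType) (F : Y -> A -> R) M g g' :
  (forall y, dom y -> g y = g' y) -> affine_in F M g -> affine_in F M g'.
Proof.
move=> h [w [b [hw hb hg]]]; exists w, b; split=> // y dy.
by rewrite -h ?hg.
Qed.

Lemma affine_in_coord (A : finType) (F : Y -> A -> R) a : affine_in F 1 (fun y => F y a).
Proof.
exists (fun a' => (a' == a)%:R), 0; rewrite normr0; split=> // [a'|y _].
  by case: eqP; rewrite ?normr1 ?normr0.
rewrite addr0 (bigD1 a) //= eqxx mul1r big1 ?addr0 // => i /negbTE ->.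
by rewrite mul0r.
Qed.

Lemma affine_in_const (A : finType) (F : Y -> A -> R) c : affine_in F `|c| (fun=> c).
Proof.
exists (fun=> 0), c; split=> // [a|y _]; first by rewrite normr0.
by rewrite big1 ?add0r // => i _; rewrite mul0r.
Qed.

Lemma affine_inD (A : finType) (F : Y -> A -> R) M M' g g' :
  affine_in F M g -> affine_in F M' g' -> affine_in F (M + M') (fun y => g y + g' y).
Proof.
move=> [w [b [hw hb hg]]] [w' [b' [hw' hb' hg']]].
exists (fun a => w a + w' a), (b + b'); split=> [a||y dy].
- by rewrite (le_trans (ler_normD _ _)) // lerD.
- by rewrite (le_trans (ler_normD _ _)) // lerD.
- rewrite hg // hg' // addrACA -big_split /=; congr (_ + _).
  by apply: eq_bigr => i _; rewrite mulrDl.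
Qed.

Lemma affine_inZ (A : finType) (F : Y -> A -> R) M g c :
  affine_in F M g -> affine_in F (`|c| * M) (fun y => c * g y).
Proof.
move=> [w [b [hw hb hg]]]; exists (fun a => c * w a), (c * b); split=> [a||y dy].
- by rewrite normrM ler_wpM2l.
- by rewrite normrM ler_wpM2l.
- rewrite hg // mulrDr mulr_sumr; congr (_ + _); apply: eq_bigr => i _.
  by rewrite mulrA.
Qed.

Lemma affine_inB (A : finType) (F : Y -> A -> R) M M' g g' :
  affine_in F M g -> affine_in F M' g' -> affine_in F (M + M') (fun y => g y - g' y).
Proof.
move=> h /(affine_inZ (-1)); rewrite normrN1 mul1r => h'.
by apply: affine_in_eq (affine_inD h h') => y _; rewrite mulN1r.
Qed.

Lemma affine_in_sum (A : finType) (F : Y -> A -> R) (I : Type) (r : seq I) (P : pred I)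
    (M : I -> R) (g : I -> Y -> R) :
  (forall i, P i -> affine_in F (M i) (g i)) ->
  affine_in F (\sum_(i <- r | P i) M i) (fun y => \sum_(i <- r | P i) g i y).
Proof.
move=> h; elim: r => [|i r IH].
  have := affine_in_const F 0; rewrite normr0 big_nil.
  by apply: affine_in_eq => y _; rewrite big_nil.
rewrite big_cons; case: ifP => Pi; last first.
  by apply: affine_in_eq IH => y _; rewrite big_cons Pi.
by apply: affine_in_eq (affine_inD (h i Pi) IH) => y _; rewrite big_cons Pi.
Qed.

Lemma affine_in_coordZ (A : finType) (F : Y -> A -> R) a c : affine_in F `|c| (fun y => c * F y a).
Proof. by have := affine_inZ c (affine_in_coord F a); rewrite mulr1. Qed.

Definition layer W := ('M[R]_(W, W) * 'cV[R]_W)%type.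

Definition layer_step W (h : 'cV[R]_W) (l : layer W) := reluM (l.1 *m h + l.2).

(** States are taken after the ReLU, so paths concatenate without merging affine maps. [k] counts
    layers, [c] bounds the nonzero parameters and [M] their size. *)
Definition relu_path W (k c : nat) (M : R) (A B : finType)
    (F : Y -> A -> R) (G : Y -> B -> R) : Prop :=
  exists l : seq (layer W),
    [/\ size l = k, (\sum_(x <- l) (nnz x.1 + nnz x.2) <= c)%N,
        forall x, x \in l -> mx_bnd x.1 M /\ mx_bnd x.2 M &
        forall y, dom y -> foldl (@layer_step W) (emb W (F y)) l = emb W (G y)].

Lemma relu_path_nil W M (A : finType) (F : Y -> A -> R) : relu_path W 0 0 M F F.
Proof. by exists [::]; split=> //; rewrite big_nil. Qed.

Lemma relu_path_cat W k c k' c' M (A B C : finType) (F : Y -> A -> R) (G : Y -> B -> R)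
    (H : Y -> C -> R) :
  relu_path W k c M F G -> relu_path W k' c' M G H ->
  relu_path W (k + k') (c + c') M F H.
Proof.
move=> [l [h1 h2 h3 h4]] [l' [h1' h2' h3' h4']]; exists (l ++ l'); split.
- by rewrite size_cat h1 h1'.
- by rewrite big_cat leq_add.
- by move=> x; rewrite mem_cat => /orP[/h3|/h3'].
- by move=> y dy; rewrite foldl_cat h4 // h4'.
Qed.

Lemma relu_path_mono W k c c' M M' (A B : finType) (F : Y -> A -> R) (G : Y -> B -> R) :
  (c <= c')%N -> M <= M' -> relu_path W k c M F G -> relu_path W k c' M' F G.
Proof.
move=> cc MM [l [h1 h2 h3 h4]]; exists l; split=> //; first exact: leq_trans cc.
by move=> x /h3[hx hx']; split=> i j; apply: le_trans MM.
Qed.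

Lemma affine_layer (A B : finType) W W' (F : Y -> A -> R) (g : Y -> B -> R) M :
  0 <= M -> (#|A| <= W)%N -> (forall b, affine_in F M (g ^~ b)) ->
  exists (w : 'M[R]_(W', W)) (b : 'cV[R]_W'),
   [/\ mx_bnd w M, mx_bnd b M, (nnz w + nnz b <= #|B| * #|A|.+1)%N &
       forall y, dom y -> w *m emb W (F y) + b = emb W' (g y)].
Proof.
move=> M0 hA /fin_all_exists[w /fin_all_exists[b h]].
exists (embM W W' w), (emb W' b); split.
- by apply: embM_bnd => // i j; case: (h i).
- by apply: emb_bnd => // i; case: (h i).
- by rewrite mulnS addnC leq_add ?nnz_emb ?nnz_embM.
- move=> y dy; rewrite embM_mul // embD; congr emb; apply: funext => i.
  by case: (h i) => _ _ ->.
Qed.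

Lemma relu_path_layer (A B : finType) W (F : Y -> A -> R) (G : Y -> B -> R) M :
  0 <= M -> (#|A| <= W)%N ->
  (forall b, exists2 g, affine_in F M g &
     forall y, dom y -> G y b = Num.max (g y) 0) ->
  relu_path W 1 (#|B| * #|A|.+1) M F G.
Proof.
move=> M0 hA /fin_all_exists2[g hg hG].
have [w [b [h1 h2 h3 h4]]] := @affine_layer _ B W W F (fun y b => g b y) M M0 hA hg.
exists [:: (w, b)]; split=> //; first by rewrite big_cons big_nil addn0.
  by move=> x; rewrite inE => /eqP ->.
move=> y dy /=; rewrite /layer_step /= h4 // reluM_emb; congr emb.
by apply: funext => j; rewrite hG.
Qed.

Lemma fnn_of_path (A0 A1 B1 B : finType) a b W k c M (F0 : Y -> A0 -> R) (F1 : Y -> A1 -> R)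
    (G : Y -> B1 -> R) (O : Y -> B -> R) :
  0 <= M -> (#|A0| <= a)%N -> (#|B1| <= W)%N ->
  (forall i, exists2 g, affine_in F0 M g &
     forall y, dom y -> F1 y i = Num.max (g y) 0) ->
  relu_path W k c M F1 G ->
  (forall i, affine_in G M (O ^~ i)) ->
  exists f : fnn R a b W,
    [/\ fnn_depth f = k.+2,
        (fnn_nparams f <= #|A1| * #|A0|.+1 + c + #|B| * #|B1|.+1)%N,
        fnn_bnd f M &
        forall y, dom y -> fnn_eval f (emb a (F0 y)) = emb b (O y)].
Proof.
move=> M0 ha hb /fin_all_exists2[g hg hG] [l [h1 h2 h3 h4]] hO.
have [w1 [b1 [k1 k2 k3 k4]]] := @affine_layer _ A1 a W F0 (fun y b => g b y) M M0 ha hg.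
have [w2 [b2 [m1 m2 m3 m4]]] := @affine_layer _ B W b G O M M0 hb hO.
exists (FNN w1 b1 l w2 b2); split.
- by rewrite /fnn_depth /= h1.
- by rewrite /fnn_nparams /= -!addnA addnA leq_add // leq_add.
- by split=> //; split=> //; split.
- move=> y dy; rewrite /fnn_eval /= k4 // reluM_emb.
  have -> : (fun i => Num.max (g i y) 0) = F1 y by apply: funext => i; rewrite hG.
  by rewrite -[X in _ *m X + _]/(foldl (@layer_step W) _ l) h4 // m4.
Qed.

End Nets.

(** * Approximate products *)


Section SquareApprox.
Variable R : realType.
Implicit Types x t p f : R.

(** The tent map on [0, 1], as an affine combination of two ReLU features. *)
Definition tooth t : R := 2 * Num.max t 0 - 4 * Num.max (t - 2^-1) 0.

Definition teeth k x := iter k tooth x.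

(** On [0, 1], the piecewise linear interpolant of the square at the multiples of [2^-k]. *)
Fixpoint sqapx k x : R :=
  if k is k'.+1 then sqapx k' x - teeth k x * 4^-1 ^+ k else x.

Lemma quarter_exp_le1 k : (4^-1 : R) ^+ k <= 1.
Proof. by apply: exprn_ile1; rewrite ?invr_ge0 ?invf_le1 // ler1n. Qed.

Lemma tooth_itv t : 0 <= t <= 1 -> 0 <= tooth t <= 1.
Proof.
move=> /andP[h0 h1]; rewrite /tooth (max_idPl h0).
by case: (lerP (t - 2^-1) 0) => h; apply/andP; split; lra.
Qed.

Lemma teeth_itv k x : 0 <= x <= 1 -> 0 <= teeth k x <= 1.
Proof. by move=> h; elim: k => //= k IH; apply: tooth_itv. Qed.

(* The self-similarity [t - t^2 = T/4 + (T - T^2)/4], [T = tooth t], of the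
   parabola under the tent map. *)
Lemma sqapxE k x : 0 <= x <= 1 ->
  sqapx k x - x ^+ 2 = (teeth k x - teeth k x ^+ 2) * 4^-1 ^+ k.
Proof.
move=> hx; elim: k => [|k IH] /=; first by rewrite expr0 mulr1.
rewrite addrAC IH (exprS 4^-1) -/(teeth k x); set q := 4^-1 ^+ k.
have /andP[h0 h1] := teeth_itv k hx.
rewrite /tooth (max_idPl h0).
by case: (lerP (teeth k x - 2^-1) 0) => h; field.
Qed.

Lemma sqapx_itv k x : 0 <= x <= 1 ->
  0 <= sqapx k x - x ^+ 2 <= 4^-1 * 4^-1 ^+ k.
Proof.
move=> hx; rewrite sqapxE //; have /andP[h0 h1] := teeth_itv k hx.
have q0 : 0 <= (4^-1 : R) ^+ k by rewrite exprn_ge0 ?invr_ge0.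
have ? : 0 <= teeth k x - teeth k x ^+ 2 <= 4^-1.
  have := sqr_ge0 (teeth k x - 2^-1); have := mulr_ge0 h0 (etrans (subr_ge0 _ _) h1).
  by rewrite sqrrB mulrBr mulr1 -expr2; lra.
by apply/andP; split; [apply: mulr_ge0 | apply: ler_wpM2r] => //; lra.
Qed.

Lemma sqapx_ge0 k x : 0 <= x <= 1 -> 0 <= sqapx k x.
Proof. by move=> /(sqapx_itv k)/andP[h _]; have := sqr_ge0 x; lra. Qed.

(* The shift by [4^-r/2] makes this a lower bound of [p * f], so that iterated
   products stay in the unit interval. *)
Definition mulapx r p f : R :=
  Num.max (2 * sqapx r ((p + f) / 2) - sqapx r p / 2 - sqapx r f / 2
           - 4^-1 ^+ r / 2) 0.

(** Polarization. With [q = 4^-r], each [sqapx] overshoots by at most [q/4], so the three squares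
    together err by between [-q/4] and [q/2]; the shift turns this into a deficit of at most [3q/4],
    and clipping at 0 moves towards [p * f >= 0]. *)
Lemma mulapxP r p f : 0 <= p <= 1 -> 0 <= f <= 1 ->
  0 <= mulapx r p f <= 1 /\ `|mulapx r p f - p * f| <= 4^-1 ^+ r.
Proof.
move=> hp hf.
have hm : 0 <= (p + f) / 2 <= 1 by lra.
have /andP[a1 a2] := sqapx_itv r hp.
have /andP[b1 b2] := sqapx_itv r hf.
have /andP[c1 c2] := sqapx_itv r hm.
have q0 : 0 <= (4^-1 : R) ^+ r by rewrite exprn_ge0 ?invr_ge0.
have pf0 : 0 <= p * f by rewrite mulr_ge0; lra.
have pf1 : p * f <= 1 by rewrite mulr_ile1; lra.
have e : 2 * ((p + f) / 2) ^+ 2 - p ^+ 2 / 2 - f ^+ 2 / 2 = p * f by field.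
rewrite /mulapx.
move: (4^-1 ^+ r) (sqapx r ((p + f) / 2)) (sqapx r p) (sqapx r f) a1 a2 b1 b2 c1 c2 q0.
move=> q s s1 s2 a1 a2 b1 b2 c1 c2 q0.
by case: (lerP (2 * s - s1 / 2 - s2 / 2 - q / 2) 0) => h; rewrite ler_norml;
  split; apply/andP; split; lra.
Qed.

Definition prodapx r (p : R) (fs : seq R) : R := foldl (mulapx r) p fs.

Lemma prodapxP r p fs : 0 <= p <= 1 -> (forall f, f \in fs -> 0 <= f <= 1) ->
  0 <= prodapx r p fs <= 1 /\
  `|prodapx r p fs - p * \prod_(f <- fs) f| <= (size fs)%:R * 4^-1 ^+ r.
Proof.
elim: fs p => [|f fs IH] p hp hfs.
  by rewrite big_nil mulr1 subrr normr0 mul0r.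
have hf : 0 <= f <= 1 by apply: hfs; rewrite mem_head.
have hfs' g : g \in fs -> 0 <= g <= 1 by move=> h; apply: hfs; rewrite inE h orbT.
have [k1 k2] := mulapxP r hp hf.
have [m1 m2] := IH _ k1 hfs'.
split=> //; rewrite big_cons mulrA /= -natr1 mulrDl mul1r.
(* The error of this multiplication is only damped by the remaining factors, which lie in the unit
   interval; so errors add up over the factors. *)
have -> : prodapx r p (f :: fs) - p * f * \prod_(j <- fs) j =
  (prodapx r (mulapx r p f) fs - mulapx r p f * \prod_(j <- fs) j) +
  (mulapx r p f - p * f) * \prod_(j <- fs) j by rewrite /=; ring.
rewrite (le_trans (ler_normD _ _)) // lerD // normrM.
have : `|\prod_(j <- fs) j| <= 1.
  rewrite normr_prod; elim: (fs) hfs' => [|g gs IHg] hg; first by rewrite big_nil.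
  rewrite big_cons mulr_ile1 // ?prodr_ge0 //.
    by have /andP[g0 g1] := hg g (mem_head _ _); rewrite ger0_norm.
  by apply: IHg => j hj; apply: hg; rewrite inE hj orbT.
by move=> h; rewrite -[leRHS]mulr1 ler_pM.
Qed.

End SquareApprox.

(** * Parallel products of features by ReLU layers *)

Section ProductNet.
Variables (R : realType) (Y : Type) (dom : Y -> Prop) (E T : finType).
Variables (F : Y -> E -> R) (W r : nat).
Hypothesis F_itv : forall y e, dom y -> 0 <= F y e <= 1.

(** The features [F] travel alongside the running values, since every later multiplication needs a
    fresh factor. *)
Definition sum_state (A : Type) (P : Y -> A -> R) (y : Y) (z : E + A) : R :=
  match z with inl e => F y e | inr t => P y t end.

(** The first option names the number being squared: [p], [f] or, for [None], their mean. The second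
    names the stored quantity: the sawtooth ([None]), its excess over 1/2 ([Some true]) or the
    partial sum of the square ([Some false]). *)
Let sqT := (T * option bool * option bool)%type.

Definition mul_card := #|{: E + sqT}|.

Section Step.
Variables (sel : T -> E) (P : Y -> T -> R).
Hypothesis P_itv : forall y t, dom y -> 0 <= P y t <= 1.
Hypothesis hW : (mul_card <= W)%N.

Let X y t o : R := match o with
  | None => (P y t + F y (sel t)) / 2
  | Some true => P y t
  | Some false => F y (sel t) end.

Let G k y (z : sqT) : R := match z.2 with
  | None => teeth k (X y z.1.1 z.1.2)
  | Some true => Num.max (teeth k (X y z.1.1 z.1.2) - 2^-1) 0
  | Some false => sqapx k (X y z.1.1 z.1.2) end.

Let X_itv y t o : dom y -> 0 <= X y t o <= 1.
Proof.
move=> dy; have h1 := P_itv t dy; have h2 := F_itv (sel t) dy.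
by case: o => [[]|] //=; lra.
Qed.

Let carry A (P' : Y -> A -> R) (S : finType) (H : Y -> S -> R) M e s :
  1 <= M -> (forall y, H y s = F y e) ->
  exists2 g, affine_in dom H M g &
     forall y, dom y -> sum_state P' y (inl e) = Num.max (g y) 0.
Proof.
move=> M1 h; exists (fun y => H y s); first exact: affine_in_mono (affine_in_coord _ _ _).
by move=> y dy /=; rewrite h; have /andP[/max_idPl -> _] := F_itv e dy.
Qed.

Let ST_le : (#|{: E + T}| <= mul_card)%N.
Proof.
by rewrite /mul_card !card_sum !card_prod card_option card_bool; nia.
Qed.

Let path_start :
  relu_path dom W 1 (mul_card * mul_card.+1) 7 (sum_state P) (sum_state (G 0)).
Proof.
apply: (relu_path_mono _ (lexx _) (relu_path_layer _ (leq_trans ST_le hW) _)) => //.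
  by rewrite leq_mul // ltnS.
move=> [e|[[t o] o']]; first by apply: (@carry _ _ _ _ _ e (inl e)) => //; lra.
have aX : affine_in dom (sum_state P) 1 (fun y => X y t o).
  case: o => [[]|] /=.
  - exact: (affine_in_coord _ (sum_state P) (inr t)).
  - exact: (affine_in_coord _ (sum_state P) (inl (sel t))).
  - have := affine_inZ 2^-1 (affine_inD (affine_in_coord dom (sum_state P) (inr t))
      (affine_in_coord dom (sum_state P) (inl (sel t)))).
    rewrite ger0_norm ?invr_ge0 // => h; apply: affine_in_mono (affine_in_eq _ h); first by lra.
    by move=> y _ /=; rewrite mulrC.
case: o' => [[]|] /=.
- exists (fun y => X y t o - 2^-1) => //.
  apply: affine_in_mono (affine_inB aX (affine_in_const _ _ _)).
  by rewrite ger0_norm ?invr_ge0 //; lra.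
- exists (fun y => X y t o); first by apply: affine_in_mono aX; lra.
  by move=> y dy; have /andP[/max_idPl -> _] := X_itv t o dy.
- exists (fun y => X y t o); first by apply: affine_in_mono aX; lra.
  by move=> y dy; have /andP[/max_idPl -> _] := X_itv t o dy.
Qed.

(** One layer per tooth: with both [teeth k] and its excess over 1/2 in the state, the next tooth is
    affine in the state. *)
Let path_square k :
  relu_path dom W k (k * (mul_card * mul_card.+1)) 7 (sum_state (G 0)) (sum_state (G k)).
Proof.
elim: k => [|k IH]; first by rewrite mul0n; apply: relu_path_nil.
rewrite mulSnr -{1}addn1; apply: relu_path_cat IH _.
apply: relu_path_layer => //.
move=> [e|[[t o] o']]; first by apply: (@carry _ _ _ _ _ e (inl e)) => //; lra.
pose A := fun y => 2 * sum_state (G k) y (inr (t, o, None)) -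
                   4 * sum_state (G k) y (inr (t, o, Some true)).
(* The tent map costs [2 + 4] in weights; the partial sum adds 1 to at most this, which is the
   origin of the bound 7, uniform in [k]. *)
have aA : affine_in dom (sum_state (G k)) 6 A.
  apply: affine_in_mono (affine_inB (affine_in_coordZ _ _ _ _) (affine_in_coordZ _ _ _ _)).
  by rewrite !ger0_norm ?invr_ge0 //; lra.
have AE y : dom y -> A y = teeth k.+1 (X y t o).
  move=> dy; rewrite /A /= /tooth.
  by have /andP[/max_idPl -> _] := teeth_itv k (X_itv t o dy).
case: o' => [[]|] /=.
- exists (fun y => A y - 2^-1); last by move=> y dy; rewrite AE.
  apply: affine_in_mono (affine_inB aA (affine_in_const _ _ _)).
  by rewrite ger0_norm ?invr_ge0 //; lra.
- exists (fun y => sum_state (G k) y (inr (t, o, Some false)) - 4^-1 ^+ k.+1 * A y).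
    apply: affine_in_mono (affine_inB (affine_in_coord _ _ _) (affine_inZ _ aA)).
    rewrite ger0_norm ?divr_ge0 ?exprn_ge0 ?invr_ge0 //.
    have := quarter_exp_le1 R k.+1.
    by lra.
  move=> y dy; rewrite /= AE // mulrC.
  by rewrite -[RHS]/(Num.max (sqapx k.+1 (X y t o)) 0);
    have /max_idPl -> := sqapx_ge0 k.+1 (X_itv t o dy).
- exists A; first by apply: affine_in_mono aA; lra.
  by move=> y dy; rewrite AE //; have /andP[/max_idPl -> _] := teeth_itv k.+1 (X_itv t o dy).
Qed.

Let path_end :
  relu_path dom W 1 (mul_card * mul_card.+1) 7 (sum_state (G r))
    (sum_state (fun y t => mulapx r (P y t) (F y (sel t)))).
Proof.
apply: (relu_path_mono _ (lexx _) (relu_path_layer _ hW _)) => //.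
  by rewrite leq_mul.
move=> [e|t]; first by apply: (@carry _ _ _ _ _ e (inl e)) => //; lra.
exists (fun y => 2 * sum_state (G r) y (inr (t, None, Some false))
   - 2^-1 * sum_state (G r) y (inr (t, Some true, Some false))
   - 2^-1 * sum_state (G r) y (inr (t, Some false, Some false)) - 4^-1 ^+ r / 2).
  apply: affine_in_mono (affine_inB (affine_inB (affine_inB (affine_in_coordZ _ _ _ _)
    (affine_in_coordZ _ _ _ _)) (affine_in_coordZ _ _ _ _)) (affine_in_const _ _ _)).
  rewrite !ger0_norm ?divr_ge0 ?exprn_ge0 ?invr_ge0 //.
  have := quarter_exp_le1 R r.
  by lra.
by move=> y dy /=; rewrite /mulapx ![2^-1 * _]mulrC.
Qed.

Lemma mul_path :
  relu_path dom W r.+2 (r.+2 * (mul_card * mul_card.+1)) 7 (sum_state P)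
    (sum_state (fun y t => mulapx r (P y t) (F y (sel t)))).
Proof.
have := relu_path_cat (relu_path_cat path_start (path_square r)) path_end.
by rewrite -mulSn -mulSnr add1n addn1.
Qed.

End Step.

Lemma prod_path (sels : seq (T -> E)) (P : Y -> T -> R) :
  (mul_card <= W)%N -> (forall y t, dom y -> 0 <= P y t <= 1) ->
  relu_path dom W (size sels * r.+2) (size sels * (r.+2 * (mul_card * mul_card.+1))) 7
    (sum_state P)
    (sum_state (fun y t => prodapx r (P y t) [seq F y (sel t) | sel : T -> E <- sels])).
Proof.
move=> hW; elim: sels P => [|sel sels IH] P hP; first exact: relu_path_nil.
rewrite /= !mulSn; apply: relu_path_cat (mul_path sel hP hW) (IH _ _) => y t dy.
by have [] := mulapxP r (hP y t dy) (F_itv (sel t) dy).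
Qed.

End ProductNet.

(** * Staircases and tabulated functions *)


Section Staircases.
Variable R : realType.
Implicit Types (u t : R) (K k n : nat).

Definition ramp t : R := Num.max t 0 - Num.max (t - 1) 0.

Lemma rampP t : [/\ t <= 0 -> ramp t = 0, 1 <= t -> ramp t = 1,
  0 <= t <= 1 -> ramp t = t & 0 <= ramp t <= 1].
Proof.
rewrite /ramp; case: (lerP t 0) => h1; case: (lerP (t - 1) 0) => h2;
  split=> *; try (apply/andP; split); lra.
Qed.

(** For sums of ramps: those before cell [k] are saturated at 1, those after it are still 0, and
    only one is in transit. *)
Lemma sum_plateau n k (beta c : nat -> R) : (k < n)%N ->
  (forall j, (j < k)%N -> c j = 1) -> (forall j, (k < j)%N -> c j = 0) ->
  \sum_(j < n) beta j * c j = \sum_(j < k) beta j + beta k * c k.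
Proof.
move=> kn h1 h0; elim: n kn => // n IH; rewrite ltnS leq_eqVlt big_ord_recr /=.
case/orP=> [/eqP <-|kn]; last by rewrite IH // (h0 n) // mulr0 addr0.
by congr (_ + _); apply: eq_bigr => j _; rewrite h1 ?mulr1.
Qed.

Lemma unit_cell n u : (0 < n)%N -> 0 <= u <= n%:R ->
  exists2 j, (j < n)%N & j%:R <= u <= j%:R + 1.
Proof.
elim: n => // n IH _ /andP[h0 h1].
case: (lerP n%:R u) => h; first by exists n => //; rewrite h natr1.
case: n IH h h1 => [|n] IH h h1; first by lra.
have [||j hj hu] := IH; rewrite ?h0 ?ltW //.
by exists j => //; apply: ltn_trans hj _.
Qed.

(** Each unit cell is cut into quarters, and [k] is the quarter in which the staircase climbs by
    one. *)
Definition stair K k u : R := \sum_(j < K) ramp (4 * (u - j%:R) - k%:R).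

Lemma stair_cell K k u j : (j < K)%N -> (k <= 3)%N -> j%:R <= u <= j%:R + 1 ->
  stair K k u = j%:R + ramp (4 * (u - j%:R) - k%:R).
Proof.
move=> jK k3 /andP[h1 h2]; rewrite /stair.
have k3' : 0 <= (k%:R : R) <= 3 by rewrite ler0n (ler_nat R k 3).
under eq_bigr do rewrite -[ramp _]mul1r.
rewrite (@sum_plateau _ j (fun=> 1) (fun j => ramp (4 * (u - j%:R) - k%:R))) //.
- by rewrite sumr_const card_ord mul1r.
- move=> i ij; have [_ -> //] := rampP (4 * (u - i%:R) - k%:R).
  have : (i.+1%:R : R) <= j%:R by rewrite ler_nat.
  by rewrite -natr1; lra.
- move=> i ij; have [-> //] := rampP (4 * (u - i%:R) - k%:R).
  have : (j.+1%:R : R) <= i%:R by rewrite ler_nat.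
  by rewrite -natr1; lra.
Qed.

(** Over the four quarters of a cell, [cutoff false] is 0, rises, is 1 and falls. It vanishes on the
    first quarter, where [stair 0] climbs; its complement vanishes on the third, where [stair 2]
    climbs. *)
Definition cutoff K (b : bool) u : R :=
  if b then 1 - (stair K 1 u - stair K 3 u) else stair K 1 u - stair K 3 u.

Definition base K (b : bool) u : R := stair K (if b then 2%N else 0%N) u.

Lemma cutoff_itv K b u : (0 < K)%N -> 0 <= u <= K%:R -> 0 <= cutoff K b u <= 1.
Proof.
move=> K0 hu; have [j jK hj] := unit_cell K0 hu.
rewrite /cutoff !(stair_cell jK _ hj) //.
have [a1 a2 a3 a4] := rampP (4 * (u - j%:R) - 1).
have [b1 b2 b3 b4] := rampP (4 * (u - j%:R) - 3).
have : ramp (4 * (u - j%:R) - 3) <= ramp (4 * (u - j%:R) - 1).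
  case: (lerP (4 * (u - j%:R) - 3) 0) => h; first by rewrite b1 //; lra.
  by rewrite a2; lra.
by case: b; lra.
Qed.

Lemma base_itv K b u : (0 < K)%N -> 0 <= u <= K%:R -> 0 <= base K b u <= K%:R.
Proof.
move=> K0 hu; have [j jK hj] := unit_cell K0 hu.
rewrite /base (stair_cell jK _ hj); last by case: b.
set t := _ - _; have [_ _ _ h] := rampP t.
have : (j.+1%:R : R) <= K%:R by rewrite ler_nat.
by have := ler0n R j; rewrite -natr1; lra.
Qed.

(** A nonzero cutoff puts the staircase on a plateau. The plateaus have the [K + 1] heights 0, ...,
    [K], which is why cells are later numbered in base [K.+1]. *)
Lemma base_cutoff K b u : (0 < K)%N -> 0 <= u <= K%:R -> cutoff K b u != 0 ->
  exists c : 'I_K.+1, base K b u = c%:R /\ `|u - c%:R| <= 1.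
Proof.
move=> K0 hu; have [j jK hj] := unit_cell K0 hu.
rewrite /cutoff /base !(stair_cell jK _ hj) //; last by case: b.
have [a1 a2 a3 a4] := rampP (4 * (u - j%:R) - 1).
have [b1 b2 b3 b4] := rampP (4 * (u - j%:R) - 3).
have [c1 c2 c3 c4] := rampP (4 * (u - j%:R)).
have [d1 d2 d3 d4] := rampP (4 * (u - j%:R) - 2).
have jS : (j < K.+1)%N by rewrite ltnW.
have jS1 : (j.+1 < K.+1)%N by [].
case: b => /eqP h; last first.
  exists (Ordinal jS1); rewrite /= ?mulr0n subr0 -[j.+1%:R]natr1 ler_norml.
  suff : 1 <= 4 * (u - j%:R).
    by move=> h'; rewrite c2 //; split=> //; apply/andP; split; lra.
  case: (lerP (4 * (u - j%:R) - 1) 0) => h1; last by lra.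
  by case: h; rewrite a1 // b1; lra.
case: (lerP (4 * (u - j%:R) - 2) 0) => h2.
  exists (Ordinal jS); rewrite /= d1 // addr0 ler_norml; split=> //.
  by apply/andP; split; lra.
exists (Ordinal jS1); rewrite /= -[j.+1%:R]natr1 ler_norml.
suff : 1 <= 4 * (u - j%:R) - 2.
  by move=> h'; rewrite d2 //; split=> //; apply/andP; split; lra.
case: (lerP (4 * (u - j%:R) - 3) 0) => h3; last by lra.
by case: h; rewrite a2 ?b1; lra.
Qed.

Definition interp n (al : nat -> R) t : R :=
  al 0%N + \sum_(j < n) (al j.+1 - al j) * ramp (t - j%:R).

Lemma interp_cell n al t k : (k < n)%N -> k%:R <= t <= k%:R + 1 ->
  interp n al t = al k + (al k.+1 - al k) * (t - k%:R).
Proof.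
move=> kn hk; rewrite /interp.
rewrite (@sum_plateau _ k (fun j => al j.+1 - al j) (fun j => ramp (t - j%:R))) //.
- have [_ _ r3 _] := rampP (t - k%:R); rewrite r3; last by lra.
  rewrite addrA; congr (_ + _).
  by elim: (k) => [|i IH]; rewrite ?big_ord0 ?addr0 // big_ord_recr /= addrA IH; ring.
- move=> i ij; have [_ -> //] := rampP (t - i%:R).
  have : (i.+1%:R : R) <= k%:R by rewrite ler_nat.
  by rewrite -natr1; lra.
- move=> i ij; have [-> //] := rampP (t - i%:R).
  have : (k.+1%:R : R) <= i%:R by rewrite ler_nat.
  by rewrite -natr1; lra.
Qed.

(** Needed where the argument is no cell number: the value returned there is meaningless but must
    still be a legal factor for the product network. *)
Lemma interp_itv n al t : (0 < n)%N -> 0 <= t <= n%:R ->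
  (forall j, 0 <= al j <= 1) -> 0 <= interp n al t <= 1.
Proof.
move=> n0 /(unit_cell n0)[k kn hk] h; rewrite (interp_cell _ kn hk).
have /andP[a0 a1] := h k; have /andP[b0 b1] := h k.+1.
have [s0 s1] : 0 <= t - k%:R /\ 0 <= 1 - (t - k%:R) by split; lra.
move: (t - k%:R) s0 s1 => s s0 s1.
have := mulr_ge0 s0 b0; have := mulr_ge0 s1 a0.
have : 0 <= s * (1 - al k.+1) by apply: mulr_ge0; lra.
have : 0 <= (1 - s) * (1 - al k) by apply: mulr_ge0; lra.
by move=> *; apply/andP; split; nra.
Qed.

Lemma interp_nat n al k : (0 < n)%N -> (k <= n)%N -> interp n al k%:R = al k.
Proof.
move=> n0; rewrite leq_eqVlt => /orP[/eqP ->|kn].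
  case: n n0 => // n _; rewrite (@interp_cell _ _ _ n) // -natr1; last by lra.
  by ring.
by rewrite (interp_cell _ kn); [ring|lra].
Qed.

End Staircases.

(** * Numbering of cells by digits *)

Section Radix.
Variable I : finType.

Definition radix (b : nat) (c : I -> nat) : nat := \sum_i c i * b ^ enum_rank i.

Definition digit (b j : nat) (i : I) : nat := (j %/ b ^ enum_rank i) %% b.

Let radix_ord b c :
  radix b c = (\sum_(r < #|I|) c (enum_val r) * b ^ r)%N.
Proof.
rewrite /radix (reindex (@enum_val I I)) /=; last first.
  by exists (@enum_rank I) => x _; rewrite ?enum_valK ?enum_rankK.
by apply: eq_bigr => r _; rewrite enum_valK.
Qed.

Let radix_ord_lt b n (f : 'I_n -> nat) :
  (forall r, f r < b)%N -> (\sum_(r < n) f r * b ^ r < b ^ n)%N.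
Proof.
elim: n f => [|n IH] f h; first by rewrite big_ord0.
rewrite big_ord_recr /= expnS.
have := IH (fun r => f (widen_ord (leqnSn n) r)) (fun r => h _).
have := h ord_max; set s := (\sum_(i < n) _)%N => h1 h2.
apply: leq_trans (_ : (f ord_max).+1 * b ^ n <= _)%N; last by rewrite leq_mul2r h1 orbT.
by rewrite mulSn ltn_add2r.
Qed.

Let radix_ord_digit b n (f : 'I_n -> nat) (r : 'I_n) :
  (forall r, f r < b)%N -> ((\sum_(r < n) f r * b ^ r) %/ b ^ r %% b = f r)%N.
Proof.
elim: n f r => [|n IH] f r h; first by case: r.
have b0 : (0 < b)%N by apply: leq_trans (h r).
rewrite big_ord_recl /= expn0 muln1.
have -> : (\sum_(i < n) f (lift ord0 i) * b ^ bump 0 i =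
           b * \sum_(i < n) f (lift ord0 i) * b ^ i)%N.
  rewrite big_distrr /=; apply: eq_bigr => k _.
  by rewrite /bump /= add1n expnS mulnCA.
case: (unliftP ord0 r) => [j ->|->] /=.
  rewrite /bump /= add1n expnS divnMA.
  have -> (s : nat) : ((f ord0 + b * s) %/ b)%N = s.
    by rewrite addnC mulnC divnMDl // divn_small // addn0.
  by rewrite (IH (fun k => f (lift ord0 k))).
by rewrite expn0 divn1 [X in (_ + X)%N]mulnC addnC modnMDl modn_small.
Qed.

Lemma radix_lt b c : (forall i, c i < b)%N -> (radix b c < b ^ #|I|)%N.
Proof. by rewrite radix_ord => h; apply: radix_ord_lt. Qed.

Lemma digit_radix b c i : (forall i, c i < b)%N -> digit b (radix b c) i = c i.
Proof.
move=> h; rewrite radix_ord /digit.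
by rewrite (@radix_ord_digit b _ (fun r => c (enum_val r))) ?enum_rankK.
Qed.

End Radix.

(** * The memorizing network *)


Lemma ler1_absB (R : realType) (a b : R) : 0 <= a <= 1 -> 0 <= b <= 1 -> `|a - b| <= 1.
Proof. by move=> ha hb; rewrite ler_norml; apply/andP; split; lra. Qed.

Section MemoNet.
Variables (R : realType) (Y : Type) (dom : Y -> Prop) (I Q T : finType).
Variables (x : Y -> I -> R) (o : Y -> Q -> R).
Hypothesis x_itv : forall y i, dom y -> 0 <= x y i <= 1.
Hypothesis o_itv : forall y q, dom y -> 0 <= o y q <= 1.
Variables (K : nat) (nu : T -> {ffun I -> bool}) (al : T -> nat -> R).
Hypothesis K_gt0 : (0 < K)%N.
Hypothesis I_gt0 : (0 < #|I|)%N.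
Hypothesis al_itv : forall t j, 0 <= al t j <= 1.

(** The [unit] index is the constant feature 1, a neutral factor that fills up monomials of low
    degree. *)
Definition raw_idx : finType := (I + Q + unit)%type.
Definition feat_idx : finType := (I * bool + raw_idx)%type.

Definition raw y (e : raw_idx) : R :=
  match e with inl (inl i) => x y i | inl (inr q) => o y q | inr _ => 1 end.

Definition feat : Y -> feat_idx -> R := fun y e =>
  match e with inl (i, b) => cutoff K b (K%:R * x y i) | inr e => raw y e end.

(** The predecessor, because this counts the intervals between consecutive cell numbers; it is also
    the largest cell number. *)
Definition ncell : nat := (K.+1 ^ #|I|).-1.

Definition cell_code y (v : {ffun I -> bool}) : R :=
  \sum_i (K.+1 ^ enum_rank i)%:R * base K (v i) (K%:R * x y i).

Definition memo y t : R := interp ncell (al t) (cell_code y (nu t)).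

Lemma ncellS : ncell.+1 = (K.+1 ^ #|I|)%N.
Proof. by rewrite /ncell prednK // expn_gt0. Qed.

Lemma ncell_ge : (K <= ncell)%N.
Proof. by rewrite -ltnS ncellS -{1}(expn1 K.+1) leq_exp2l. Qed.

Let Kx_itv y i : dom y -> 0 <= K%:R * x y i <= K%:R.
Proof.
move=> dy; have /andP[h0 h1] := x_itv i dy.
by rewrite mulr_ge0 //= ler_piMr.
Qed.

Lemma raw_itv y e : dom y -> 0 <= raw y e <= 1.
Proof. by case: e => [[i|q]|u] dy; [exact: x_itv|exact: o_itv|rewrite ler01 lexx]. Qed.

Lemma feat_itv y e : dom y -> 0 <= feat y e <= 1.
Proof.
case: e => [[i b]|e] dy; last exact: raw_itv.
by apply: cutoff_itv => //; apply: Kx_itv.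
Qed.

Lemma cell_code_itv y v : dom y -> 0 <= cell_code y v <= ncell%:R.
Proof.
move=> dy; rewrite /cell_code; apply/andP; split.
  apply: sumr_ge0 => i _; rewrite mulr_ge0 //.
  by have /andP[] := base_itv (v i) K_gt0 (Kx_itv i dy).
apply: (@le_trans _ _ (radix K.+1 (fun _ : I => K))%:R); last first.
  by rewrite ler_nat -ltnS ncellS radix_lt.
rewrite /radix natr_sum; apply: ler_sum => i _.
rewrite natrM mulrC ler_wpM2r //.
by have /andP[] := base_itv (v i) K_gt0 (Kx_itv i dy).
Qed.

Lemma cell_code_nat y (v : {ffun I -> bool}) (c : I -> 'I_K.+1) :
  (forall i, base K (v i) (K%:R * x y i) = (c i)%:R) ->
  cell_code y v = (radix K.+1 (fun i => c i))%:R.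
Proof.
move=> h; rewrite /cell_code /radix natr_sum; apply: eq_bigr => i _.
by rewrite h natrM mulrC.
Qed.

Lemma memo_itv y t : dom y -> 0 <= memo y t <= 1.
Proof.
move=> dy; apply: interp_itv => //; last exact: cell_code_itv.
exact: leq_trans K_gt0 ncell_ge.
Qed.

(** The summand [2 * #|I|] pays for the cell code, whose weights are powers of [K.+1] times the
    weight [2 * K] of a staircase; the 9 covers knots, cutoffs, shifts and interpolation. *)
Definition memo_bnd : R := ((2 * #|I| + 9) * K.+1 * ncell.+1)%:R.

Let le_bnd n : (n <= 9 * K.+1 * ncell.+1)%N -> n%:R <= memo_bnd.
Proof.
move=> h; rewrite /memo_bnd ler_nat (leq_trans h) // -!mulnA leq_mul2r.
by rewrite leq_addl orbT.
Qed.

Let bnd1 : 1 <= memo_bnd. Proof. by apply: (@le_bnd 1); lia. Qed.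
Let bnd0 : 0 <= memo_bnd. Proof. exact: le_trans bnd1. Qed.

Lemma carry_relu (S : finType) (H : Y -> S -> R) M (g : Y -> R) s :
  1 <= M -> (forall y, dom y -> 0 <= g y) -> (forall y, H y s = g y) ->
  exists2 g', affine_in dom H M g' & forall y, dom y -> g y = Num.max (g' y) 0.
Proof.
move=> M1 h0 h; exists (fun y => H y s); first exact: affine_in_mono (affine_in_coord _ _ _).
by move=> y dy /=; rewrite h; have /max_idPl -> := h0 y dy.
Qed.

(** The breakpoints are the multiples of [1 / (4 * K)], common to the four staircases, so one layer
    serves all of them. *)
Definition knot y (z : I * 'I_(4 * K).+1) : R :=
  Num.max (4 * K%:R * x y z.1 - (z.2 : nat)%:R) 0.

Definition shifted y (z : {ffun I -> bool} * 'I_ncell.+1) : R :=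
  Num.max (cell_code y z.1 - (z.2 : nat)%:R) 0.

Lemma knot_layer (A0 : finType) (F0 : Y -> A0 -> R) :
  (forall i, affine_in dom F0 1 (x ^~ i)) -> (forall q, affine_in dom F0 1 (o ^~ q)) ->
  forall e, exists2 g, affine_in dom F0 memo_bnd g &
    forall y, dom y -> sum_state raw knot y e = Num.max (g y) 0.
Proof.
move=> hx ho [[[i|q]|u]|[i l]].
- exists (x ^~ i); first exact: affine_in_mono (hx i).
  by move=> y dy /=; have /andP[/max_idPl -> _] := x_itv i dy.
- exists (o ^~ q); first exact: affine_in_mono (ho q).
  by move=> y dy /=; have /andP[/max_idPl -> _] := o_itv q dy.
- exists (fun=> 1); last by move=> y dy /=; have /max_idPl -> := @ler01 R.
  by have := affine_in_const dom F0 1; rewrite normr1; apply: affine_in_mono.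
- exists (fun y => 4 * K%:R * x y i - (l : nat)%:R) => //.
  apply: affine_in_mono (affine_inB (affine_inZ _ (hx i)) (affine_in_const _ _ _)).
  rewrite mulr1 !ger0_norm ?mulr_ge0 //.
  have hl : (l <= 4 * K)%N by rewrite -ltnS.
  by rewrite -natrM -natrD; apply: le_bnd; nia.
Qed.

Lemma stair_affine (A : finType) (H : Y -> A -> R) (s : I * 'I_(4 * K).+1 -> A) k i :
  (forall y z, H y (s z) = knot y z) -> (k <= 3)%N ->
  affine_in dom H (2 * K)%:R (fun y => stair K k (K%:R * x y i)).
Proof.
move=> hs k3.
have -> : (2 * K)%:R = \sum_(j < K) (1 + 1) :> R.
  by rewrite sumr_const card_ord natrM mulr_natr.
apply: affine_in_sum => j _.
(* The last knot needed is [4 * (K - 1) + 3 + 1 = 4 * K]. *)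
have jK (c : nat) : (c <= 1)%N -> (4 * j + k + c < (4 * K).+1)%N.
  by have := ltn_ord j; lia.
pose z c := (i, inord (4 * j + k + c) : 'I_(4 * K).+1).
have E c y : (c <= 1)%N -> H y (s (z c)) =
    Num.max (4 * (K%:R * x y i - (j : nat)%:R) - k%:R - c%:R) 0.
  move=> hc; rewrite hs /knot /= inordK ?jK //; congr Num.max.
  have -> : (4 * j + k + c)%:R = 4 * j%:R + k%:R + c%:R :> R by rewrite 2!natrD natrM.
  by ring.
apply: affine_in_eq (affine_inB (affine_in_coord _ H (s (z 0%N)))
                                (affine_in_coord _ H (s (z 1%N)))) => y _.
by rewrite /ramp !E // subr0.
Qed.

Lemma code_layer W : (#|{: raw_idx + I * 'I_(4 * K).+1}| <= W)%N ->
  relu_path dom W 1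
    (#|{: feat_idx + {ffun I -> bool}}| * #|{: raw_idx + I * 'I_(4 * K).+1}|.+1) memo_bnd
    (sum_state raw knot) (sum_state feat cell_code).
Proof.
move=> hW; apply: relu_path_layer => //.
have st k i : (k <= 3)%N ->
    affine_in dom (sum_state raw knot) (2 * K)%:R (fun y => stair K k (K%:R * x y i)).
  by move=> h; apply: (stair_affine (s := inr)) h.
move=> [[[i b]|e]|v].
- have h : affine_in dom (sum_state raw knot) (4 * K + 1)%:R
      (fun y => cutoff K b (K%:R * x y i)).
    have hB := affine_inB (st 1%N i isT) (st 3%N i isT).
    case: b; last first.
      by apply: affine_in_mono hB; rewrite -natrD ler_nat; lia.
    apply: affine_in_mono (affine_inB (affine_in_const _ _ 1) hB).
    by rewrite normr1 -natrD -(natrD _ 1) ler_nat; lia.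
  exists (fun y => cutoff K b (K%:R * x y i)).
    by apply: affine_in_mono h; apply: le_bnd; nia.
  by move=> y dy /=; have /andP[/max_idPl -> _] := cutoff_itv b K_gt0 (Kx_itv i dy).
- apply: (@carry_relu _ _ _ (fun y => raw y e) (inl e)) => // y dy.
  by have /andP[] := raw_itv e dy.
- exists (cell_code ^~ v); last first.
    by move=> y dy /=; have /andP[/max_idPl -> _] := cell_code_itv v dy.
  apply: (@affine_in_mono _ _ _ _ _ (\sum_(i : I) ncell.+1%:R * (2 * K)%:R)); last first.
    apply: affine_in_sum => i _.
    have hs : affine_in dom (sum_state raw knot) (2 * K)%:R
        (fun y => base K (v i) (K%:R * x y i)) by apply: st; case: (v i).
    apply: affine_in_mono (affine_inZ _ hs).
    rewrite ger0_norm // ler_wpM2r // ler_nat ncellS leq_exp2l //.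
    exact: ltnW.
  rewrite sumr_const -natrM -mulrnA ler_nat.
  apply: (@leq_trans (2 * #|I| * K.+1 * ncell.+1)); last by rewrite !leq_mul2r leq_addr !orbT.
  have -> : (ncell.+1 * (2 * K) * #|I| = 2 * #|I| * K * ncell.+1)%N by ring.
  by rewrite !leq_mul2r !leq_mul2l leqnSn !orbT.
Qed.

Lemma shift_layer W : (#|{: feat_idx + {ffun I -> bool}}| <= W)%N ->
  relu_path dom W 1
    (#|{: feat_idx + {ffun I -> bool} * 'I_ncell.+1}| *
     #|{: feat_idx + {ffun I -> bool}}|.+1) memo_bnd
    (sum_state feat cell_code) (sum_state feat shifted).
Proof.
move=> hW; apply: relu_path_layer => // -[e|[v j]].
  apply: (@carry_relu _ _ _ (fun y => feat y e) (inl e)) => // y dy.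
  by have /andP[] := feat_itv e dy.
exists (fun y => sum_state feat cell_code y (inr v) - (j : nat)%:R) => //.
apply: affine_in_mono (affine_inB (affine_in_coord _ _ _) (affine_in_const _ _ _)).
rewrite ger0_norm // -(natrD _ 1); apply: le_bnd.
by have := ltn_ord j; nia.
Qed.

Lemma memo_layer W : (#|{: feat_idx + {ffun I -> bool} * 'I_ncell.+1}| <= W)%N ->
  relu_path dom W 1
    (#|{: feat_idx + T}| * #|{: feat_idx + {ffun I -> bool} * 'I_ncell.+1}|.+1) memo_bnd
    (sum_state feat shifted) (sum_state feat memo).
Proof.
move=> hW; apply: relu_path_layer => // -[e|t].
  apply: (@carry_relu _ _ _ (fun y => feat y e) (inl e)) => // y dy.
  by have /andP[] := feat_itv e dy.
exists (memo ^~ t); last first.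
  by move=> y dy /=; have /andP[/max_idPl -> _] := memo_itv t dy.
pose S := sum_state feat shifted.
have hr (j : 'I_ncell) :
    affine_in dom S 2 (fun y => (al t j.+1 - al t j) * ramp (cell_code y (nu t) - (j : nat)%:R)).
  have h : affine_in dom S (1 + 1) (fun y => ramp (cell_code y (nu t) - (j : nat)%:R)).
    have j1 : (j < ncell.+1)%N by rewrite ltnS ltnW.
    have j2 : (j.+1 < ncell.+1)%N by rewrite ltnS.
    apply: affine_in_eq (affine_inB (affine_in_coord _ S (inr (nu t, Ordinal j1)))
      (affine_in_coord _ S (inr (nu t, Ordinal j2)))) => y _.
    by rewrite /S /= /shifted /= /ramp -natr1 opprD addrA.
  apply: affine_in_mono (affine_inZ _ h).
  by have := ler1_absB (al_itv t j.+1) (al_itv t j); lra.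
apply: affine_in_mono (affine_inD (affine_in_const _ _ (al t 0%N))
  (affine_in_sum _ (fun j _ => hr j))).
rewrite sumr_const card_ord -(mulr_natr 2 ncell) -natrM.
apply: (@le_trans _ _ (1 + 2 * ncell)%:R); last by apply: le_bnd; nia.
by rewrite natrD lerD2r; have := al_itv t 0%N; rewrite ler_norml; lra.
Qed.

(** [D] collects all sizes that do not depend on [K]. Knots and shifted codes have size proportional
    to the number of cells at most, but each is adjacent only to layers of size at most [D], so no
    matrix holds more than linearly many nonzero entries. The 5 in the depth counts knots, codes,
    shifted codes, tabulated values and output. *)
Lemma memo_net (A0 B : finType) (F0 : Y -> A0 -> R) (sels : seq (T -> feat_idx))
    (coef : B -> T -> R) (a b W r : nat) (M : R) :
  let out := fun y p => \sum_t coef p t *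
     prodapx r (memo y t) [seq feat y (sel t) | sel : T -> feat_idx <- sels] in
  let D := (#|A0| + #|raw_idx| + #|I| + #|feat_idx| + #|{ffun I -> bool}| + #|T| +
            mul_card feat_idx T + #|B| + 1)%N in
  (#|A0| <= a)%N -> (6 * D * ncell.+1 <= W)%N ->
  memo_bnd <= M -> (forall p, \sum_t `|coef p t| <= M) ->
  (forall i, affine_in dom F0 1 (x ^~ i)) -> (forall q, affine_in dom F0 1 (o ^~ q)) ->
  exists f : fnn R a b W,
    [/\ fnn_depth f = (size sels * r.+2 + 5)%N,
        (fnn_nparams f <= 40 * D * D * ncell.+1 + size sels * r.+2 * (2 * D * D))%N,
        fnn_bnd f M &
        forall y, dom y -> fnn_eval f (emb a (F0 y)) = emb b (out y)].
Proof.
move=> out D ha hW hM hcoef hx ho.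
have M0 : 0 <= M by apply: le_trans hM.
have N1 : (0 < ncell.+1)%N by [].
have KN : (K <= ncell)%N := ncell_ge.
pose kf := #|feat_idx|; pose kv := #|{ffun I -> bool}|; pose kt := #|T|.
pose kr := #|raw_idx|; pose ki := #|I|.
have e1 : #|{: raw_idx + I * 'I_(4 * K).+1}| = (kr + ki * (4 * K).+1)%N.
  by rewrite card_sum card_prod card_ord.
have e2 : #|{: feat_idx + {ffun I -> bool}}| = (kf + kv)%N by rewrite card_sum.
have e3 : #|{: feat_idx + {ffun I -> bool} * 'I_ncell.+1}| = (kf + kv * ncell.+1)%N.
  by rewrite card_sum card_prod card_ord.
have e4 : #|{: feat_idx + T}| = (kf + kt)%N by rewrite card_sum.
have DE : D = (#|A0| + kr + ki + kf + kv + kt + mul_card feat_idx T + #|B| + 1)%N by [].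
clearbody D kf kv kt kr ki.
have [d1 d2 d3 d4 c5] : [/\ #|A0|.+1 <= D, kr + ki <= D, #|B| <= D,
  kf + kv + kt <= D & mul_card feat_idx T < D]%N by rewrite DE; split; lia.
have DN : (D <= D * ncell.+1)%N by rewrite leq_pmulr.
have c1 : (#|{: raw_idx + I * 'I_(4 * K).+1}| <= 5 * D * ncell.+1)%N.
  have : (ki * (4 * K).+1 <= D * (4 * ncell.+1))%N by apply: leq_mul; lia.
  by rewrite e1; lia.
have c2 : (#|{: feat_idx + {ffun I -> bool}}| <= D)%N by rewrite e2; lia.
have c3 : (#|{: feat_idx + {ffun I -> bool} * 'I_ncell.+1}| <= 2 * D * ncell.+1)%N.
  have : (kv * ncell.+1 <= D * ncell.+1)%N by apply: leq_mul; lia.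
  by rewrite e3; lia.
have c4 : (#|{: feat_idx + T}| <= D)%N by rewrite e4; lia.
have DW : (D <= W)%N by lia.
have bW : (2 * D * ncell.+1 <= W)%N by lia.
have hW' : (5 * D * ncell.+1 <= W)%N by lia.
have p1 := code_layer (leq_trans c1 hW').
have p2 := shift_layer (leq_trans c2 DW).
have p3 := memo_layer (leq_trans c3 bW).
have p4 := prod_path r feat_itv sels (leq_trans (ltnW c5) DW) (fun y t => @memo_itv y t).
have p := relu_path_cat (relu_path_mono (leqnn _) hM
            (relu_path_cat (relu_path_cat p1 p2) p3)) (relu_path_mono (leqnn _) _ p4).
have {p1 p2 p3 p4}p := p (le_trans (@le_bnd 7 _) hM).
have hk e : exists2 g, affine_in dom F0 M g &
    forall y, dom y -> sum_state raw knot y e = Num.max (g y) 0.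
  by have [g hg hg'] := knot_layer hx ho e; exists g => //; apply: affine_in_mono hg.
have hO i : affine_in dom (sum_state feat (fun y t => prodapx r (memo y t)
    [seq feat y (sel t) | sel : T -> feat_idx <- sels])) M (out ^~ i).
  apply: affine_in_mono (hcoef i) _; apply: affine_in_sum => t _.
  exact: (affine_in_coordZ _ (sum_state feat _) (inr t)).
have {}p := p ltac:(nia).
have [f [f1 f2 f3 f4]] := fnn_of_path b M0 ha (leq_trans c4 DW) hk p hO.
exists f; split=> //; first by rewrite f1; lia.
apply: leq_trans f2 _.
move: c1 c2 c3 c4 c5; rewrite {e1 e2 e3 e4}.
move: #|{: raw_idx + I * 'I_(4 * K).+1}| #|{: feat_idx + {ffun I -> bool}}|
  #|{: feat_idx + {ffun I -> bool} * 'I_ncell.+1}| #|{: feat_idx + T}|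
  (mul_card feat_idx T) => k1 k2 k3 k4 k5 c1 c2 c3 c4 c5.
pose DDN := (D * (D * ncell.+1))%N.
have g1 : (k1 * #|A0|.+1 <= 5 * DDN)%N.
  by apply: leq_trans (leq_mul c1 d1) _; rewrite /DDN; lia.
have g2 : (k2 * k1.+1 <= 6 * DDN)%N.
  by apply: (@leq_trans (D * (6 * D * ncell.+1))); [apply: leq_mul; lia | rewrite /DDN; lia].
have g3 : (k3 * k2.+1 <= 4 * DDN)%N.
  apply: (@leq_trans ((2 * D * ncell.+1) * (2 * D))); last by rewrite /DDN; lia.
  by apply: leq_mul; lia.
have g4 : (k4 * k3.+1 <= 3 * DDN)%N.
  by apply: (@leq_trans (D * (3 * D * ncell.+1))); [apply: leq_mul; lia | rewrite /DDN; lia].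
have g5 : (#|B| * k4.+1 <= 2 * DDN)%N.
  apply: (@leq_trans (D * (2 * (D * ncell.+1)))); last by rewrite /DDN; lia.
  by apply: leq_mul; lia.
have g6 : (size sels * (r.+2 * (k5 * k5.+1)) <= size sels * r.+2 * (2 * D * D))%N.
  rewrite mulnA leq_mul2l; apply/orP; right.
  by apply: (@leq_trans (D * D)); [apply: leq_mul; lia | lia].
by move: g1 g2 g3 g4 g5 g6; rewrite /DDN; lia.
Qed.

End MemoNet.

(** * Taylor expansion in one variable *)


Section OneVariable.
Variable R : realType.

(** The one-variable form of [partial_on_cube]: increments stay in the interval, so derivatives at
    its ends are one-sided. *)
Definition deriv_within (a b : R) (f df : R -> R) : Prop :=
  forall t, a <= t <= b -> forall e : R, 0 < e -> exists2 del : R, 0 < del &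
    forall u : R, u != 0 -> `|u| < del -> a <= t + u <= b ->
      `|(f (t + u) - f t) / u - df t| <= e.

Lemma deriv_within_is_derive a b f df t : deriv_within a b f df -> a < t < b ->
  is_derive t 1 f (df t).
Proof.
move=> h /andP[at' tb].
have cv : ((fun u => u^-1 *: ((f \o shift t) (u *: 1) - f t)) @ 0^' --> df t)%classic.
  apply/cvgrPdist_le => e e0.
  have [del del0 hd] := h t (introT andP (conj (ltW at') (ltW tb))) e e0.
  have m0 : 0 < Num.min del (Num.min (t - a) (b - t)).
    by rewrite !lt_min del0 !subr_gt0 at' tb.
  near=> u; rewrite distrC /= [u *: 1]mulr1 [_ *: _]mulrC addrC [u + t]addrC.
  have : `|u| < Num.min del (Num.min (t - a) (b - t)).
    near: u; apply: nbhs_dnbhs; exists (Num.min del (Num.min (t - a) (b - t))) => //=.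
    by move=> u /=; rewrite sub0r normrN.
  rewrite !lt_min => /and3P[u1 u2 u3]; rewrite addrC; apply: hd => //.
    by near: u; exact: nbhs_dnbhs_neq.
  by move: u2 u3; rewrite !ltr_norml; lra.
apply: DeriveDef; first by apply/cvg_ex; exists (df t).
exact: cvg_lim cv.
Unshelve. all: by end_near.
Qed.

Lemma deriv_within_cts a b f df : a < b -> deriv_within a b f df ->
  {within `[a, b], continuous f}%classic.
Proof.
move=> ab h; apply/continuous_within_itvP => //.
(* The difference quotient at [t] is bounded by [1 + |df t|] nearby, which gives continuity at the
   ends as well. *)
have key t : a <= t <= b -> forall e, 0 < e -> exists2 del, 0 < del &
    forall s, `|s - t| < del -> a <= s <= b -> `|f t - f s| <= e.
  move=> ht e e0; have [del del0 hd] := h t ht 1 ltr01.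
  have q0 : 0 < 1 + `|df t| by rewrite ltr_pwDl.
  exists (Num.min del (e / (1 + `|df t|))); first by rewrite lt_min del0 divr_gt0.
  move=> s; rewrite lt_min => /andP[s1 s2] hs.
  have [->|st] := eqVneq s t; first by rewrite subrr normr0 ltW.
  have u0 : s - t != 0 by rewrite subr_eq0.
  have := hd (s - t) u0 s1; rewrite addrC subrK => /(_ hs) h1.
  have -> : f t - f s = - (((f s - f t) / (s - t) - df t + df t) * (s - t)).
    by rewrite subrK divfK // opprB.
  rewrite normrN normrM; move: s2; rewrite ltr_pdivlMr // => s2.
  apply: le_trans (ltW s2); rewrite mulrC ler_wpM2l //.
  by rewrite (le_trans (ler_normD _ _)) // lerD2r.
split.
- move=> t; rewrite in_itv /= => /andP[at' tb].
  apply/differentiable_continuous/derivable1_diffP.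
  by have [] := deriv_within_is_derive h (introT andP (conj at' tb)).
- apply/cvgrPdist_le => e e0.
  have [|del del0 hd] := key a _ e e0; first by rewrite lexx ltW.
  near=> s; apply: hd.
    have s1 : a < s by near: s; exact: nbhs_right_gt.
    have s2 : s < a + del by near: s; apply: nbhs_right_lt; rewrite ltrDl.
    by rewrite gtr0_norm; lra.
  apply/andP; split; apply: ltW.
    by near: s; exact: nbhs_right_gt.
  by near: s; exact: nbhs_right_lt.
- apply/cvgrPdist_le => e e0.
  have [|del del0 hd] := key b _ e e0; first by rewrite lexx ltW.
  near=> s; apply: hd.
    have s1 : s < b by near: s; exact: nbhs_left_lt.
    have s2 : b - del < s by near: s; apply: nbhs_left_gt; rewrite ltrBlDr ltrDl.
    by rewrite ltr0_norm; lra.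
  apply/andP; split; apply: ltW.
    by near: s; exact: nbhs_left_gt.
  by near: s; exact: nbhs_left_lt.
Unshelve. all: by end_near.
Qed.

Lemma deriv_withinW a b a' b' f df : a <= a' -> b' <= b ->
  deriv_within a b f df -> deriv_within a' b' f df.
Proof.
move=> aa bb h t ht e e0; have [|del del0 hd] := h t _ e e0; first by lra.
by exists del => // u u0 ud hu; apply: hd => //; lra.
Qed.

Lemma mvt_poly_bound a b f df (p : {poly R}) M : a <= b -> deriv_within a b f df ->
  (forall t, a <= t <= b -> `|df t - p^`().[t]| <= M) ->
  `|(f b - p.[b]) - (f a - p.[a])| <= M * (b - a).
Proof.
rewrite le_eqVlt => /predU1P[->|ab] h hM; first by rewrite !subrr normr0 mulr0.
have [| |c hc ->] := @MVT R (f \- horner p) (fun t => df t - p^`().[t]) a b ab.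
- move=> t; rewrite in_itv /= => ht.
  apply: is_deriveB; exact: deriv_within_is_derive h ht.
- have hf := deriv_within_cts ab h; move=> t; apply: cvgB; first exact: hf.
  by apply: continuous_subspaceT => u; apply: continuous_horner.
move: hc; rewrite in_itv /= => /andP[h1 h2].
rewrite normrM [`|b - a|]gtr0_norm ?subr_gt0 // ler_wpM2r ?subr_ge0 //; first exact: ltW.
by apply: hM; rewrite !ltW.
Qed.

Lemma taylor1 a b k (phi : nat -> R -> R) L lam : a <= 0 <= b -> 0 <= L -> 0 < lam ->
  (forall j, (j < k)%N -> deriv_within a b (phi j) (phi j.+1)) ->
  (forall t, a <= t <= b -> `|phi k t - phi k 0| <= L * `|t| `^ lam) ->
  forall t, a <= t <= b ->
  `|phi 0%N t - \sum_(j < k.+1) t ^+ j / j`!%:R * phi j 0| <= L * `|t| `^ (k%:R + lam).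
Proof.
move=> hab L0 lam0.
elim: k phi => [|k IH] phi hder hL t ht.
  by rewrite big_ord1 expr0 fact0 divr1 mul1r add0r hL.
pose p : {poly R} := \poly_(j < k.+2) (phi j 0 / j`!%:R).
have pE u : p.[u] = \sum_(j < k.+2) u ^+ j / j`!%:R * phi j 0.
  by rewrite horner_poly; apply: eq_bigr => j _; ring.
(* The derivative of the Taylor polynomial is the Taylor polynomial of the derivative, to which the
   induction hypothesis applies. *)
have dpE u : p^`().[u] = \sum_(j < k.+1) u ^+ j / j`!%:R * phi j.+1 0.
  rewrite -[p^`()]/(deriv p) (_ : p^`() = \poly_(j < k.+1) (phi j.+1 0 / j`!%:R)).
    by rewrite horner_poly; apply: eq_bigr => j _; ring.
  apply/polyP => j; rewrite coef_deriv !coef_poly ltnS; case: ifP => _; last by rewrite mul0rn.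
  have n1 : j.+1%:R != 0 :> R by rewrite pnatr_eq0.
  have n2 : j`!%:R != 0 :> R by rewrite pnatr_eq0 -lt0n fact_gt0.
  rewrite -[LHS]mulr_natr factS natrM; move: (j.+1%:R) (j`!%:R) n1 n2 => A B n1 n2.
  by field; rewrite n1 n2.
have hd u : a <= u <= b -> `|u| <= `|t| ->
    `|phi 1%N u - p^`().[u]| <= L * `|t| `^ (k%:R + lam).
  move=> hu ut.
  rewrite dpE (le_trans (IH (fun j => phi j.+1) _ _ u hu)) //.
  - by move=> j jk; apply: hder.
  - by rewrite ler_wpM2l // ge0_ler_powR ?nnegrE // addr_ge0 // ltW.
have p0 : phi 0%N 0 - p.[0] = 0.
  rewrite pE big_ord_recl expr0 fact0 divr1 mul1r big1 ?addr0 ?subrr // => j _.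
  by rewrite exprS mul0r !mul0r.
have -> : L * `|t| `^ (k.+1%:R + lam) = L * `|t| `^ (k%:R + lam) * `|t|.
  rewrite -natr1 addrAC powRD ?powRr1 ?mulrA //.
  by rewrite gt_eqF // addr_gt0 // ltr_wpDl.
rewrite -pE; have h01 := hder 0%N isT.
case: (lerP 0 t) => t0.
  have hd' u : 0 <= u <= t -> `|phi 1%N u - p^`().[u]| <= L * `|t| `^ (k%:R + lam).
    by move=> hu; apply: hd; rewrite ?(ger0_norm t0) ?ger0_norm; lra.
  have h02 : deriv_within 0 t (phi 0%N) (phi 1%N) by apply: deriv_withinW h01; lra.
  have := mvt_poly_bound t0 h02 hd'.
  by rewrite p0 !subr0 [X in _ -> _ <= _ * X](ger0_norm t0).
have hd' u : t <= u <= 0 -> `|phi 1%N u - p^`().[u]| <= L * `|t| `^ (k%:R + lam).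
  by move=> hu; apply: hd; rewrite ?(ltr0_norm t0) ?ler0_norm; lra.
have h02 : deriv_within t 0 (phi 0%N) (phi 1%N) by apply: deriv_withinW h01; lra.
have := mvt_poly_bound (ltW t0) h02 hd'.
by rewrite p0 !sub0r normrN [X in _ -> _ <= _ * X](ltr0_norm t0).
Qed.

End OneVariable.

(** * Local polynomial approximation *)


Section WordPolynomials.
Variables (R : realType) (d n : nat).
Local Notation I := ('I_d * 'I_n)%type.
Local Notation mx := 'M[R]_(d, n).
Implicit Types (X : mx) (g : mx -> R) (o : option I).

(** [None] is the factor 1, so every monomial of degree at most [k] is a word of length exactly [k]
    and all terms of the network multiply equally many factors. *)
Definition letter X o : R := oapp (fun i => X i.1 i.2) 1 o.

Definition word_mon k (w : k.-tuple (option I)) X : R := \prod_(o <- w) letter X o.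

Definition word_poly k (B : R) g : Prop :=
  exists2 a : k.-tuple (option I) -> R, forall w, `|a w| <= B &
    forall X, g X = \sum_w a w * word_mon w X.

Lemma word_poly_const B c : `|c| <= B -> word_poly 0 B (fun=> c).
Proof.
move=> cB; exists (fun=> c) => // X.
rewrite (big_pred1 [tuple]) => [|w]; last by apply/esym/eqP; rewrite [w]tuple0.
by rewrite /word_mon big_nil mulr1.
Qed.

Lemma word_polyD k B B' g g' : word_poly k B g -> word_poly k B' g' ->
  word_poly k (B + B') (fun X => g X + g' X).
Proof.
move=> [a ha hg] [a' ha' hg']; exists (fun w => a w + a' w) => [w|X].
  by rewrite (le_trans (ler_normD _ _)) // lerD.
by rewrite hg hg' -big_split; apply: eq_bigr => w _; rewrite mulrDl.
Qed.

Lemma word_polyZ k B c g : word_poly k B g -> word_poly k (`|c| * B) (fun X => c * g X).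
Proof.
move=> [a ha hg]; exists (fun w => c * a w) => [w|X].
  by rewrite normrM ler_wpM2l.
by rewrite hg mulr_sumr; apply: eq_bigr => w _; rewrite mulrA.
Qed.

Lemma word_poly_mono k B B' g : B <= B' -> word_poly k B g -> word_poly k B' g.
Proof. by move=> BB [a ha hg]; exists a => // w; apply: le_trans BB. Qed.

Lemma word_poly_eq k B g g' : g =1 g' -> word_poly k B g -> word_poly k B g'.
Proof. by move=> e [a ha hg]; exists a => // X; rewrite -e. Qed.

(** Words are not identified up to permutation, so multiplying by a letter only relocates
    coefficients and keeps their bound. *)
Lemma word_poly_cons k B o g : 0 <= B -> word_poly k B g ->
  word_poly k.+1 B (fun X => letter X o * g X).
Proof.
move=> B0 [a ha hg]; exists (fun w : k.+1.-tuple (option I) => if thead w == o then a [tuple of behead w] else 0).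
  by move=> w; case: ifP => // _; rewrite normr0.
move=> X; rewrite hg mulr_sumr.
rewrite [RHS](bigID (fun w : k.+1.-tuple (option I) => thead w == o)) /=.
rewrite [X in _ = _ + X]big1 => [|w /negbTE ->]; last by rewrite mul0r.
rewrite addr0 (reindex (fun w : k.-tuple (option I) => [tuple of o :: w])) /=; last first.
  exists (fun w : k.+1.-tuple (option I) => [tuple of behead w]) => w; first by move=> _; apply: val_inj.
  rewrite inE => /eqP <-; rewrite [RHS]tuple_eta; exact: val_inj.
rewrite [RHS]big_mkcond /=; apply: eq_bigr => w _; rewrite theadE eqxx.
rewrite /word_mon /= big_cons mulrCA; congr (a _ * _); exact: val_inj.
Qed.

Lemma word_poly_lift k j B g : 0 <= B -> word_poly k B g -> word_poly (j + k) B g.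
Proof.
move=> B0 h; elim: j => // j IH; rewrite addSn.
by apply: word_poly_eq (word_poly_cons None B0 IH) => X; rewrite /letter mul1r.
Qed.

Lemma word_poly_shift k B (i : I) c g : 0 <= B -> `|c| <= 1 -> word_poly k B g ->
  word_poly k.+1 (2 * B) (fun X => (X i.1 i.2 - c) * g X).
Proof.
move=> B0 c1 h.
have h1 := word_poly_cons (Some i) B0 h.
have h2 := word_polyZ (- c) (word_poly_lift 1 B0 h).
apply: word_poly_mono (word_poly_eq _ (word_polyD h1 h2)).
  by have := ler_wpM2r B0 c1; rewrite normrN; lra.
by move=> X; rewrite /letter /=; ring.
Qed.

Lemma word_poly_shiftX k j B (i : I) c g : 0 <= B -> `|c| <= 1 -> word_poly k B g ->
  word_poly (j + k) (2 ^+ j * B) (fun X => (X i.1 i.2 - c) ^+ j * g X).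
Proof.
move=> B0 c1 h; elim: j => [|j IH].
  by rewrite expr0 mul1r; apply: word_poly_eq h => X; rewrite mul1r.
rewrite addSn exprS -mulrA; apply: word_poly_eq (word_poly_shift _ _ c1 IH).
  by move=> X; rewrite exprS mulrA.
by rewrite mulr_ge0 // exprn_ge0.
Qed.

Lemma word_poly_sum (J : finType) k B (g : J -> mx -> R) :
  (forall j, word_poly k B (g j)) -> 
  word_poly k (#|J|%:R * B) (fun X => \sum_j g j X).
Proof.
move=> /fin_all_exists2[a ha hg]; exists (fun w => \sum_j a j w) => [w|X].
  rewrite (le_trans (ler_norm_sum _ _ _)) // mulr_natl -sumr_const ler_sum //.
under eq_bigr do rewrite hg.
by rewrite exchange_big; apply: eq_bigr => w _; rewrite mulr_suml.
Qed.

End WordPolynomials.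

(** * Taylor polynomials on the cube, coordinate by coordinate *)

Section LocalPolynomials.
Variables (R : realType) (d n s : nat) (lam : R).
Hypothesis lam_gt0 : 0 < lam.
Local Notation I := ('I_d * 'I_n)%type.
Local Notation mx := 'M[R]_(d, n).
Variable D : {ffun I -> nat} -> mx -> R.
Hypothesis D_partial : forall mu ij, (mi_size mu < s)%N ->
  partial_on_cube (D mu) ij (D (mi_inc mu ij)).
Variables C0 C1 : R.
Hypothesis D_bnd : forall mu x, (mi_size mu <= s)%N -> cube x -> `|D mu x| <= C0.
Hypothesis D_holder : forall mu x y, mi_size mu = s -> cube x -> cube y -> x != y ->
  `|D mu x - D mu y| <= C1 * (eucl x y) `^ lam.
Hypothesis C1_ge0 : 0 <= C1.

Let mi_add (mu : {ffun I -> nat}) i j : {ffun I -> nat} :=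
  [ffun k => mu k + j * (k == i)]%N.

Let mi_add0 mu i : mi_add mu i 0 = mu.
Proof. by apply/ffunP => k; rewrite ffunE mul0n addn0. Qed.

Let mi_addS mu i j : mi_add mu i j.+1 = mi_inc (mi_add mu i j) i.
Proof. by apply/ffunP => k; rewrite !ffunE mulSn addnA addnAC. Qed.

Let mi_size_add mu i j : mi_size (mi_add mu i j) = (mi_size mu + j)%N.
Proof.
rewrite /mi_size; under eq_bigr do rewrite ffunE.
rewrite big_split /=; congr addn.
by rewrite (bigD1 i) //= eqxx muln1 big1 ?addn0 // => k /negbTE ->; rewrite muln0.
Qed.

(** Written as a displacement along [delta_mx] to match [partial_on_cube]. *)
Let set_at (X : mx) (i : I) (t : R) : mx := X + (t - X i.1 i.2) *: delta_mx i.1 i.2.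

Let set_atE X i t k l : set_at X i t k l = if (k, l) == i then t else X k l.
Proof.
rewrite !mxE; case: i => i j /=; rewrite xpair_eqE.
case: eqP => [->|_] /=; last by rewrite mulr0 addr0.
by case: eqP => [->|_] /=; rewrite ?mulr1 ?mulr0 ?addr0 // addrC subrK.
Qed.

Let cube_set_at X i t : cube X -> 0 <= t <= 1 -> cube (set_at X i t).
Proof. by move=> h ht k l; rewrite set_atE; case: ifP. Qed.

Let eucl_set_at X i t u : eucl (set_at X i t) (set_at X i u) = `|t - u|.
Proof.
rewrite /eucl pair_big /= (bigD1 i) //= big1 => [|k /negbTE hk].
  by rewrite !set_atE -surjective_pairing eqxx addr0 sqrtr_sqr.
by rewrite !set_atE -surjective_pairing hk subrr expr0n.
Qed.

(** [k] is the smoothness left after [mu], so the last derivative has order exactly [s], the order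
    at which [D_holder] applies. *)
Let taylor_coord k mu X i c : cube X -> 0 <= c <= 1 -> (mi_size mu + k = s)%N ->
  `|D mu X - \sum_(j < k.+1) (X i.1 i.2 - c) ^+ j / j`!%:R * D (mi_add mu i j) (set_at X i c)|
  <= C1 * `|X i.1 i.2 - c| `^ (k%:R + lam).
Proof.
move=> hX hc hs.
pose phi j t := D (mi_add mu i j) (set_at X i (c + t)).
have hXi := hX i.1 i.2.
have := @taylor1 R (- c) (1 - c) k phi C1 lam _ C1_ge0 lam_gt0 _ _ (X i.1 i.2 - c) _.
have eX : set_at X i (X i.1 i.2) = X by rewrite /set_at subrr scale0r addr0.
rewrite /phi mi_add0 [c + (X i.1 i.2 - c)]addrC subrK eX [c + 0]addr0; apply=> //; try lra.
- move=> j jk t ht e e0.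
  have hm : (mi_size (mi_add mu i j) < s)%N by rewrite mi_size_add; lia.
  have ht' : 0 <= c + t <= 1 by lra.
  have [del del0 h] := D_partial i hm (cube_set_at i hX ht') e0.
  exists del => // u u0 ud hu; rewrite mi_addS.
  have e1 : set_at X i (c + (t + u)) = set_at X i (c + t) + u *: delta_mx i.1 i.2.
    by rewrite /set_at -[RHS]addrA -scalerDl; congr (_ + _ *: _); ring.
  by rewrite e1; apply: h => //; rewrite -e1; apply: cube_set_at => //; lra.
- move=> t ht; have [->|t0] := eqVneq t 0.
    by rewrite addr0 subrr normr0 mulr_ge0 ?powR_ge0.
  have hcub u : - c <= u <= 1 - c -> cube (set_at X i (c + u)).
    by move=> hu; apply: cube_set_at => //; lra.
  have c0 : cube (set_at X i c) by apply: cube_set_at.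
  have hk : mi_size (mi_add mu i k) = s by rewrite mi_size_add.
  have ne : set_at X i (c + t) != set_at X i c.
    apply/eqP => /matrixP/(_ i.1 i.2); rewrite !set_atE -surjective_pairing eqxx.
    by move=> h; case/eqP: t0; lra.
  have := D_holder hk (hcub t ht) c0 ne.
  by rewrite eucl_set_at addrAC subrr add0r.
Qed.

Let C0_ge0 : 0 <= C0.
Proof.
have h : cube (0 : mx) by move=> i j; rewrite mxE lexx ler01.
apply: le_trans (normr_ge0 _) (@D_bnd [ffun=> 0%N] 0 _ h).
by rewrite /mi_size big1 // => i _; rewrite ffunE.
Qed.

(** Induction on the list of coordinates allowed to leave the centre. Expanding along [i] to order
    [k] leaves the coefficients [D (mi_add mu i j)] at the point with coordinate [i] reset to the
    centre; the induction hypothesis approximates them to order [k - j], and the factor of size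
    [h^j] restores the full power of [h]. Independence of the coordinates outside [l] is what makes
    these approximants, evaluated at [X] itself, agree with their values at the reset point. *)
Lemma local_poly (l : seq I) : uniq l -> exists B C : R, [/\ 0 <= B, 0 <= C &
  forall c, cube c -> forall k mu, (mi_size mu + k = s)%N ->
  exists g, [/\ word_poly k B g, forall X i t, i \notin l -> g (set_at X i t) = g X
   & forall X h, cube X -> 0 <= h <= 1 ->
    (forall i, `|X i.1 i.2 - c i.1 i.2| <= h) ->
    (forall i, i \notin l -> X i.1 i.2 = c i.1 i.2) ->
    `|D mu X - g X| <= C * h `^ (k%:R + lam)]].
Proof.
elim: l => [_|i l IH /= /andP[il /IH{IH}[B [C [B0 C0' IH]]]]].
  exists C0, 0; split=> // c hc k mu hk; exists (fun=> D mu c); split=> //.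
    rewrite -(addn0 k); apply: word_poly_lift => //; apply: word_poly_const.
    by apply: D_bnd => //; lia.
  move=> X h hX hh _ e; have -> : X = c by apply/matrixP => a b; apply: (e (a, b)).
  by rewrite subrr normr0 mul0r.
exists (s.+1%:R * (2 ^+ s * B)), (C1 + s.+1%:R * C).
split=> [||c hc k mu hk]; rewrite ?addr_ge0 ?mulr_ge0 ?exprn_ge0 //.
have hi : 0 <= c i.1 i.2 <= 1 := hc _ _.
have ks : (k <= s)%N by lia.
have IH' (j : 'I_k.+1) : exists g, [/\ word_poly (k - j) B g,
    forall X i t, i \notin l -> g (set_at X i t) = g X
    & forall X h, cube X -> 0 <= h <= 1 ->
    (forall i, `|X i.1 i.2 - c i.1 i.2| <= h) ->
    (forall i, i \notin l -> X i.1 i.2 = c i.1 i.2) ->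
    `|D (mi_add mu i j) X - g X| <= C * h `^ ((k - j)%:R + lam)].
  by apply: IH => //; rewrite mi_size_add; have := ltn_ord j; lia.
have /fin_all_exists[g hg] := IH'.
exists (fun X : mx => \sum_(j < k.+1) (j`!%:R^-1 * ((X i.1 i.2 - c i.1 i.2) ^+ j * g j X))).
have fact_le1 (j : nat) : `|j`!%:R^-1 : R| <= 1.
  by rewrite ger0_norm ?invr_ge0 // invf_le1 ?ltr0n ?ler1n ?fact_gt0.
split.
- have B2 : 0 <= 2 ^+ s * B by rewrite mulr_ge0 ?exprn_ge0.
  apply: word_poly_mono (word_poly_sum (B := 2 ^+ s * B) _) => [|j].
    by rewrite card_ord ler_wpM2r // ler_nat ltnS.
  have [gj _ _] := hg j.
  have jk : (j <= k)%N by rewrite -ltnS.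
  have c1 : `|c i.1 i.2| <= 1 by rewrite ger0_norm; lra.
  have := word_polyZ (j`!%:R^-1) (word_poly_shiftX j i B0 c1 gj).
  rewrite subnKC //; apply: word_poly_mono.
  apply: (@le_trans _ _ (1 * (2 ^+ j * B))).
    by rewrite ler_wpM2r ?fact_le1 // mulr_ge0 ?exprn_ge0.
  by rewrite mul1r ler_wpM2r // ler_eXn2l ?(leq_trans jk) // ltr1n.
- move=> X i' t; rewrite inE negb_or => /andP[ii il']; apply: eq_bigr => j _.
  have [_ gj _] := hg j; rewrite gj // set_atE -surjective_pairing eq_sym.
  by rewrite (negbTE ii).
move=> X h hX hh hXc hl.
have hX' : cube (set_at X i (c i.1 i.2)) by apply: cube_set_at.
have h0 : 0 <= h by lra.
have k0 : 0 <= k%:R + lam by rewrite addr_ge0 // ltW.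
have t1 := taylor_coord i hX hi hk.
(* First the remainder of the one-variable expansion with exact coefficients, then the cost of
   approximating the coefficients. *)
have -> : D mu X - \sum_(j < k.+1) (j`!%:R^-1 * ((X i.1 i.2 - c i.1 i.2) ^+ j * g j X)) =
   (D mu X - \sum_(j < k.+1) (X i.1 i.2 - c i.1 i.2) ^+ j / j`!%:R
       * D (mi_add mu i j) (set_at X i (c i.1 i.2))) +
   \sum_(j < k.+1) (X i.1 i.2 - c i.1 i.2) ^+ j / j`!%:R *
     (D (mi_add mu i j) (set_at X i (c i.1 i.2)) - g j X).
  rewrite -addrA; congr (_ + _); rewrite -sumrN -sumrN -big_split /=.
  by apply: eq_bigr => j _; ring.
rewrite (le_trans (ler_normD _ _)) // mulrDl lerD //.
  apply: le_trans t1 _; rewrite ler_wpM2l // ge0_ler_powR ?nnegrE //.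
apply: (@le_trans _ _ (\sum_(j < k.+1) (C * h `^ (k%:R + lam)))); last first.
  by rewrite sumr_const card_ord -[leLHS]mulr_natl mulrA ler_wpM2r ?powR_ge0 // ler_wpM2r // ler_nat ltnS.
rewrite (le_trans (ler_norm_sum _ _ _)) // ler_sum // => j _.
have jk : (j <= k)%N by rewrite -ltnS.
have [_ gj1 gj2] := hg j.
have -> : h `^ (k%:R + lam) = h ^+ j * h `^ ((k - j)%:R + lam).
  rewrite -powR_mulrn // -powRD; first by rewrite natrB //; congr powR; ring.
  by rewrite gt_eqF // addrA ltr_wpDl ?addr_ge0.
rewrite !normrM normrX -mulrA [leRHS]mulrCA ler_pM ?mulr_ge0 ?exprn_ge0 //.
  by rewrite lerXn2r ?nnegrE.
rewrite -[leRHS]mul1r ler_pM // -(gj1 X i (c i.1 i.2) il).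
apply: gj2 => // i'.
- have := hXc i'; rewrite set_atE -surjective_pairing.
  by case: eqP => // -> _; rewrite subrr normr0.
- move=> hi'; rewrite set_atE -surjective_pairing; case: eqP => [->//|ne].
  by apply: hl; rewrite inE negb_or hi' andbT; apply/eqP.
Qed.

End LocalPolynomials.

Lemma holder_local_poly (R : realType) (d n s : nat) (lam : R) (f : 'M[R]_(d, n) -> R) :
  0 < lam -> holder s lam f ->
  exists B C : R, [/\ 0 <= B, 0 <= C & forall c, cube c ->
    exists2 g, word_poly s B g & forall X h, cube X -> 0 <= h <= 1 ->
      (forall i j, `|X i j - c i j| <= h) -> `|f X - g X| <= C * h `^ (s%:R + lam)].
Proof.
move=> lam0 [D [D0 Dp [C0 hC0] [C1 hC1]]].
(* The constant in [holder] comes without a sign. *)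
have hC1' mu x y : mi_size mu = s -> cube x -> cube y -> x != y ->
    `|D mu x - D mu y| <= Num.max C1 0 * (eucl x y) `^ lam.
  move=> h1 h2 h3 h4; apply: le_trans (hC1 _ _ _ h1 h2 h3 h4) _.
  by rewrite ler_wpM2r ?powR_ge0 // le_max lexx.
have C1_ge0 : 0 <= Num.max C1 0 by rewrite le_max lexx orbT.
have [B [C [B0 C0' h]]] :=
  local_poly lam0 Dp hC0 hC1' C1_ge0 (enum_uniq {: 'I_d * 'I_n}).
exists B, C; split=> // c hc.
have [|g [g1 _ g2]] := h c hc s [ffun=> 0%N].
  by rewrite /mi_size big1 // => i _; rewrite ffunE.
exists g => // X t hX ht hXc; rewrite -D0 //; apply: g2 => // i.
by rewrite mem_enum.
Qed.

(** * Rates *)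


Section Rates.
Variables (R : realType) (gam : R) (m : nat).
Hypothesis gam_gt0 : 0 < gam.
Hypothesis m_gt0 : (0 < m)%N.

Lemma powR_natX (eps : R) k : 0 < eps ->
  (eps `^ (- (1 / gam))) ^+ k = eps `^ (- (k%:R / gam)).
Proof.
by move=> e0; rewrite -powR_mulrn ?powR_ge0 // -powRrM; congr powR; ring.
Qed.

(** [K] is just above [(A / eps)^(1 / gam)] and [r] just above [|log2 (Z / eps)|]. The last bound
    absorbs the logarithm into a power of [1 / eps], since the parameters of the product layers are
    proportional to [r]. *)
Lemma rates (A Z : R) : 0 < A -> 0 < Z -> exists c : R, 0 < c /\
  forall eps, 0 < eps < 1 -> exists K r : nat, (0 < K)%N /\
  [/\ A * K%:R^-1 `^ gam <= eps, Z * 4^-1 ^+ r <= eps,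
      (K.+1 ^ m)%:R <= c * eps `^ (- (m%:R / gam)),
      (K.+1 * K.+1 ^ m)%:R <= c * eps `^ (- (m.+1%:R / gam)) &
      (r.+2)%:R <= c * (1 + ln (eps^-1)) /\ (r.+2)%:R <= c * eps `^ (- (m%:R / gam))].
Proof.
move=> A0 Z0.
(* [kap] comes from [K.+1 <= z + 2] and [E >= 1]; [c1] below comes from [r.+2 <= |y| + 3]. *)
pose kap := A `^ (1 / gam) + 2.
have kap0 : 0 < kap by rewrite ltr_wpDl ?powR_ge0.
have ln2 : 0 < ln (2 : R) by rewrite ln_gt0 // ltr1n.
pose c1 := 3 + (ln 2)^-1 + `|ln Z| / ln 2.
have a1 : 0 < (ln (2 : R))^-1 by rewrite invr_gt0.
have a2 : 0 <= `|ln Z| / ln 2 by rewrite mulr_ge0 // ltW.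
have c10 : 0 < c1 by rewrite /c1; lra.
exists (kap ^+ m + kap ^+ m.+1 + c1 + c1 * (1 + gam)).
set c := (X in 0 < X /\ _).
have kX k : 0 <= kap ^+ k by rewrite exprn_ge0 // ltW.
have cg : 0 < c1 * (1 + gam) by rewrite mulr_gt0 // addr_gt0.
have cs : [/\ kap ^+ m <= c, kap ^+ m.+1 <= c, c1 <= c & c1 * (1 + gam) <= c].
  by rewrite /c; have := kX m; have := kX m.+1; split; lra.
split; first by case: cs => _ _ h _; apply: lt_le_trans h.
move=> eps /andP[e0 e1].
pose E := eps `^ (- (1 / gam)).
have E1 : 1 <= E.
  rewrite /E -[leLHS](powRr0 eps) ger_powR ?e0 ?(ltW e1) //.
  by rewrite oppr_le0 divr_ge0 ?ler01 ?(ltW gam_gt0).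
pose z := A `^ (1 / gam) * E.
have z0 : 0 <= z by rewrite mulr_ge0 ?powR_ge0.
have zgam : z `^ gam = A / eps.
  rewrite /z powRM ?powR_ge0 // -!powRrM mulNr !divfK ?gt_eqF // powRN.
  by rewrite !powRr1 // ltW.
pose K := (Num.truncn z).+1.
have zK : z < K%:R by rewrite /K truncnS_gt.
have Kz : K.+1%:R <= kap * E.
  rewrite -natr1 -natr1 /kap mulrDl -/z.
  by have := z0; rewrite -truncn_le; lra.
pose y := ln (Z / eps) / ln 2.
pose r := (Num.truncn `|y|).+1.
have yr : y < r%:R by rewrite (le_lt_trans (ler_norm y)) // truncnS_gt.
exists K, r; split=> //.
have L0 : 0 <= ln eps^-1 by rewrite ln_ge0 // invf_ge1 // ltW.
have rL : (r.+2)%:R <= c1 * (1 + ln eps^-1).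
  have ey : y = ln Z / ln 2 + ln eps^-1 / ln 2.
    by rewrite /y lnM ?posrE ?invr_gt0 // mulrDl.
  have y1 : `|y| <= `|ln Z| / ln 2 + ln eps^-1 / ln 2.
    rewrite ey (le_trans (ler_normD _ _)) // !normrM !(ger0_norm (_ : 0 <= (ln 2)^-1)) ?invr_ge0 ?(ltW ln2) //.
    by rewrite (ger0_norm L0).
  have := normr_ge0 y; rewrite -truncn_le.
  rewrite /r -[_.+3]addn3 natrD; move: (Num.truncn `|y|)%:R => t h.
  have := mulr_ge0 L0 (ltW a1); have := mulr_ge0 a2 L0.
  rewrite /c1; move: y1 a1 a2 L0.
  move: (ln eps^-1) (`|ln Z| / ln 2) ((ln 2)^-1) `|y| h => l b v w h.
  by move=> *; nra.
have Em k : (0 < k)%N -> E <= E ^+ k by move=> k0; rewrite -[leLHS]expr1 ler_weXn2l.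
have LE : 1 + ln eps^-1 <= (1 + gam) * E ^+ m.
  have -> : ln eps^-1 = gam * ln E.
    by rewrite /E ln_powR lnV ?posrE //; field; rewrite gt_eqF.
  have lE : ln E <= E by apply/ltW/ln_sublinear; apply: lt_le_trans E1.
  have := Em m m_gt0; have := ler_wpM2l (ltW gam_gt0) lE.
  have : gam * E <= gam * E ^+ m by rewrite ler_wpM2l ?Em // ltW.
  by rewrite mulrDl mul1r; lra.
have E0 k : 0 <= E ^+ k by rewrite exprn_ge0 // (le_trans ler01).
case: cs => s1 s2 s3 s4; split.
- have -> : K%:R^-1 `^ gam = (K%:R `^ gam)^-1 :> R.
    by rewrite -powR_inv1 // -powRrM mulN1r powRN.
  rewrite ler_pdivrMr ?powR_gt0 ?ltr0n // mulrC -ler_pdivrMr // -zgam.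
  by apply: ge0_ler_powR; rewrite ?nnegrE // ltW.
- have h2 : Z / eps <= 2 ^+ r.
    rewrite -ler_ln ?posrE ?divr_gt0 ?exprn_gt0 // lnXn // -[leRHS]mulr_natl -ler_pdivrMr //.
    exact: ltW.
  have h4 : (4^-1 : R) ^+ r <= (2 ^+ r)^-1.
    by rewrite -exprVn lerXn2r ?nnegrE ?invr_ge0 // lef_pV2 ?posrE ?ltr0n // ler_nat.
  apply: le_trans (ler_wpM2l (ltW Z0) h4) _.
  by rewrite ler_pdivrMr ?exprn_gt0 // mulrC -ler_pdivrMr.
- rewrite natrX -powR_natX // -/E.
  apply: le_trans (_ : kap ^+ m * E ^+ m <= _); last by rewrite ler_wpM2r.
  by rewrite -exprMn lerXn2r ?nnegrE ?mulr_ge0 ?(le_trans ler01 E1) // ltW.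
- rewrite -expnS natrX -powR_natX // -/E.
  apply: le_trans (_ : kap ^+ m.+1 * E ^+ m.+1 <= _); last by rewrite ler_wpM2r.
  by rewrite -exprMn lerXn2r ?nnegrE ?mulr_ge0 ?(le_trans ler01 E1) // ltW.
split; first by apply: le_trans rL _; rewrite ler_wpM2r // addr_ge0.
apply: le_trans rL _; rewrite -powR_natX // -/E.
apply: (@le_trans _ _ (c1 * ((1 + gam) * E ^+ m))); first by rewrite ler_wpM2l // ltW.
by rewrite mulrA ler_wpM2r.
Qed.

End Rates.

(** * The approximant *)


Lemma sum_pairE (V : nmodType) (A B : finType) (F : A * B -> V) :
  \sum_t F t = \sum_a \sum_b F (a, b).
Proof. by rewrite pair_bigA; apply: eq_bigr => -[]. Qed.

Lemma ler_sum_term (R : numDomainType) (A : finType) (F : A -> R) a :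
  (forall i, 0 <= F i) -> F a <= \sum_i F i.
Proof. by move=> h; rewrite (bigD1 a) //= lerDl sumr_ge0. Qed.

(** Distributivity: the product over the coordinates of [cutoff true + cutoff false = 1]. *)
Lemma cutoff_sum (R : realType) (I : finType) K (u : I -> R) :
  \sum_(v : {ffun I -> bool}) \prod_i cutoff K (v i) (u i) = 1.
Proof.
rewrite -(bigA_distr_bigA (fun i b => cutoff K b (u i))).
by rewrite big1 // => i _; rewrite big_bool /cutoff /= subrK.
Qed.

Section Approximant.
Variables (R : realType) (d n s : nat) (gam B C : R).
Variable f : 'M[R]_(d, n) -> 'M[R]_(d, n).
Hypothesis d_gt0 : (0 < d)%N.
Hypothesis n_gt0 : (0 < n)%N.
Hypothesis B_gt0 : 0 < B.
Local Notation I := ('I_d * 'I_n)%type.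
Local Notation mx := 'M[R]_(d, n).
Local Notation word := (s.-tuple (option I)).
Variable a : I -> mx -> word -> R.
Hypothesis a_bnd : forall pq c w, cube c -> `|a pq c w| <= B.
Hypothesis a_approx : forall pq c X h, cube c -> cube X -> 0 <= h <= 1 ->
  (forall i j, `|X i j - c i j| <= h) ->
  `|f X pq.1 pq.2 - \sum_w a pq c w * word_mon w X| <= C * h `^ gam.
Variable K : nat.
Hypothesis K_gt0 : (0 < K)%N.

(* A term is the contribution to output entry [pq] of one class of cells, one
   monomial, and the positive or negative part of its coefficient. *)
Definition term : finType := (I * ({ffun I -> bool} * (word * bool)))%type.

(** Decodes a cell number. Digits run from 0 to [K], so every [j] gives a point of the closed cube
    and the table has legal entries everywhere. *)
Definition grid_point (j : nat) : mx :=
  \matrix_(p, q) ((digit K.+1 j (p, q))%:R / K%:R).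

(** Division by [B] puts the table in the unit interval; the sign and [B] come back in
    [out_coef]. *)
Definition term_coef (t : term) (j : nat) : R :=
  let c := a t.1 (grid_point j) t.2.2.1 in
  Num.max ((-1) ^+ t.2.2.2 * c) 0 / B.

Definition out_coef (p : 'I_d) (t : term) : R :=
  if t.1.1 == p then (-1) ^+ t.2.2.2 * B else 0.

Definition coords (y : mx * 'I_n) (i : I) : R := y.1 i.1 i.2.
Definition position (y : mx * 'I_n) (q : 'I_n) : R := (y.2 == q)%:R.
Definition in_cube (y : mx * 'I_n) : Prop := cube y.1.

(** The leading factor is the position bit of the output column: at any other token it silences the
    term. *)
Definition term_factors : seq (term -> feat_idx I 'I_n) :=
  (fun t => inr (inl (inr t.1.2)))
  :: [seq (fun t : term => inl (i, t.2.1 i)) | i <- index_enum I]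
  ++ [seq (fun t : term => if tnth t.2.2.1 j is Some i then inr (inl (inl i)) else inr (inr tt))
     | j <- index_enum 'I_s].

Lemma size_term_factors : size term_factors = (1 + d * n + s)%N.
Proof.
rewrite /= size_cat !size_map -[size (index_enum 'I_s)]sum1_size -[size _]sum1_size.
by rewrite !sum1_card card_prod !card_ord.
Qed.

Lemma grid_cube j : cube (grid_point j).
Proof.
move=> p q; rewrite mxE divr_ge0 // ler_pdivrMr ?ltr0n // mul1r ler_nat.
by rewrite -ltnS ltn_pmod.
Qed.

Lemma term_coef_itv t j : 0 <= term_coef t j <= 1.
Proof.
apply/andP; split.
  by apply: divr_ge0; [rewrite le_max lexx orbT | apply: ltW].
rewrite /term_coef ler_pdivrMr // mul1r ge_max (ltW B_gt0) andbT.
have := a_bnd t.1 t.2.2.1 (grid_cube j).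
by rewrite ler_norml; case: (t.2.2.2); rewrite ?expr1 ?expr0; lra.
Qed.

Let featy := feat coords position K.
Let tabulated := memo coords K (fun t : term => t.2.1) term_coef.

Lemma prod_term_factors y (t : term) :
  \prod_(sel <- term_factors) featy y (sel t) =
  position y t.1.2 * ((\prod_i cutoff K (t.2.1 i) (K%:R * coords y i)) *
    word_mon t.2.2.1 y.1).
Proof.
rewrite /term_factors big_cons big_cat !big_map /=; congr (_ * (_ * _)).
rewrite /word_mon big_tuple; apply: eq_bigr => j _.
by case: (tnth _ _) => [i|].
Qed.

(** The output of the last block if its products were exact. *)
Definition approximant (y : mx * 'I_n) (p : 'I_d) : R :=
  \sum_t out_coef p t * (tabulated y t * \prod_(sel <- term_factors) featy y (sel t)).

Lemma approximantE X q p : approximant (X, q) p =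
  \sum_(v : {ffun I -> bool}) (\prod_i cutoff K (v i) (K%:R * X i.1 i.2)) *
   \sum_(w : word) (B * (tabulated (X, q) ((p, q), (v, (w, false))) -
      tabulated (X, q) ((p, q), (v, (w, true))))) * word_mon w X.
Proof.
rewrite /approximant sum_pairE (bigD1 (p, q)) //= [X in _ + X]big1 ?addr0.
  rewrite sum_pairE; apply: eq_bigr => v _; rewrite sum_pairE mulr_sumr.
  apply: eq_bigr => w _; rewrite big_bool !prod_term_factors /out_coef /= !eqxx.
  rewrite /position /= eqxx expr1 expr0 /coords /=; ring.
move=> [p' q'] ne; rewrite big1 // => t _; rewrite prod_term_factors /out_coef /=.
case: eqP => [e|_]; last by rewrite mul0r.
rewrite /position /=; case: eqP => [e'|_]; last by rewrite mul0r !mulr0.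
by case/eqP: ne; rewrite e e'.
Qed.

Lemma approximant_error X q p : cube X ->
  `|approximant (X, q) p - f X p q| <= C * K%:R^-1 `^ gam.
Proof.
move=> hX; rewrite approximantE.
have K0 : 0 < K%:R :> R by rewrite ltr0n.
have hu i j : 0 <= K%:R * X i j <= K%:R.
  by have /andP[h0 h1] := hX i j; rewrite mulr_ge0 //= ler_piMr.
have S := cutoff_sum K (fun i : I => K%:R * X i.1 i.2).
(* The partition of unity is inserted on both sides, which reduces the bound to one grid at a
   time. *)
rewrite -[f X p q]mul1r -[X in X * f _ _ _]S mulr_suml -sumrB.
rewrite -[leRHS]mul1r -[X in _ <= X * _]S mulr_suml.
apply: le_trans (ler_norm_sum _ _ _) _; apply: ler_sum => v _.
rewrite -mulrBr normrM.
have P0 : 0 <= \prod_i cutoff K (v i) (K%:R * X i.1 i.2).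
  by apply: prodr_ge0 => i _; have /andP[] := cutoff_itv (v i) K_gt0 (hu i.1 i.2).
rewrite (ger0_norm P0).
(* Where the weight vanishes the tabulated values do not matter; elsewhere all staircases are on
   plateaus and the code is a true cell number. *)
have [->|Pn] := eqVneq (\prod_i cutoff K (v i) (K%:R * X i.1 i.2)) 0; first by rewrite !mul0r.
apply: ler_wpM2l => //.
have /fin_all_exists[c hc] : forall i : I, exists c : 'I_K.+1,
    base K (v i) (K%:R * X i.1 i.2) = c%:R /\ `|K%:R * X i.1 i.2 - c%:R| <= 1.
  move=> i; apply: base_cutoff => //.
  by apply: contra_neq Pn => e; rewrite (bigD1 i) //= e mul0r.
pose j := radix K.+1 (fun i => c i).
have jE : cell_code coords K (X, q) v = j%:R.
  by rewrite -(@cell_code_nat _ _ _ coords K (X, q) v c) // => i; have [] := hc i.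
have jn : (j <= ncell I K)%N by rewrite -ltnS ncellS radix_lt.
have I0 : (0 < #|{: I}|)%N by rewrite card_prod !card_ord muln_gt0 d_gt0.
have nc0 : (0 < ncell I K)%N by apply: leq_trans K_gt0 (ncell_ge _ I0).
have memoE w b : tabulated (X, q) ((p, q), (v, (w, b))) = term_coef ((p, q), (v, (w, b))) j.
  by rewrite /tabulated /memo /= jE interp_nat.
rewrite distrC.
have -> : \sum_(w : word) (B * (tabulated (X, q) ((p, q), (v, (w, false))) -
      tabulated (X, q) ((p, q), (v, (w, true))))) * word_mon w X =
    \sum_w a (p, q) (grid_point j) w * word_mon w X.
  apply: eq_bigr => w _; congr (_ * _); rewrite !memoE /term_coef /= expr0 expr1.
  rewrite -mulrBl mulrC divfK ?gt_eqF // mul1r mulN1r.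
  move: (a _ _ _) => t; case: (lerP t 0) => h; case: (lerP (- t) 0) => h'; lra.
apply: (a_approx (p, q)) => //; first exact: grid_cube.
  by rewrite invr_ge0 ler0n invf_le1 // ler1n.
move=> p' q'; rewrite mxE digit_radix //.
have [_ h] := hc (p', q').
have -> : X p' q' - (c (p', q'))%:R / K%:R = (K%:R * X p' q' - (c (p', q'))%:R) / K%:R.
  by field; rewrite gt_eqF.
rewrite normrM.
by rewrite [X in _ * X]ger0_norm ?invr_ge0 // -[leRHS]mul1r ler_wpM2r // invr_ge0.
Qed.

End Approximant.

(** * The last feedforward block *)


Lemma fnn_bnd_mono (R : realType) a b W (g : fnn R a b W) (M M' : R) :
  M <= M' -> fnn_bnd g M -> fnn_bnd g M'.
Proof.
move=> MM [h1 [h2 [h3 [h4 h5]]]].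
do 2?[split; first by move=> i j; apply: le_trans MM].
split; last by split=> i j; apply: le_trans MM.
by move=> l /h3[k1 k2]; split=> i j; apply: le_trans MM.
Qed.

Lemma sum_le_card (R : realType) (T : finType) (F : T -> R) B :
  (forall t, F t <= B) -> \sum_t F t <= #|T|%:R * B.
Proof. by move=> h; rewrite mulr_natl -sumr_const ler_sum. Qed.

Lemma leq_summands6 (a b c d e f : nat) : let S := (a + b + c + d + e + f)%N in
  [/\ a <= S, b <= S, c <= S, d <= S & e <= S /\ f <= S]%N.
Proof. by rewrite /=; split; try lia; split; lia. Qed.

Section LastBlock.
Variables (R : realType) (d n s : nat) (lam : R).
Hypothesis d_gt0 : (0 < d)%N.
Hypothesis n_gt0 : (0 < n)%N.
Hypothesis lam_gt0 : 0 < lam.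
Variable f : 'M[R]_(d, n) -> 'M[R]_(d, n).
Hypothesis f_holder : forall (p : 'I_d) (q : 'I_n), holder s lam (fun x => f x p q).
Local Notation I := ('I_d * 'I_n)%type.
Local Notation gam := (s%:R + lam).
Local Notation word := (s.-tuple (option I)).

(* Token [q] holds its own column (first summand), the whole input (second
   summand) and the one-hot code of [q]. *)
Definition token_idx : finType := (I + I + 'I_n)%type.

Definition token_state (y : 'M[R]_(d, n) * 'I_n) (e : token_idx) : R :=
  match e with
  | inl (inl i) => if i.2 == y.2 then y.1 i.1 i.2 else 0
  | inl (inr i) => y.1 i.1 i.2
  | inr q => (y.2 == q)%:R
  end.

Lemma uniform_local_poly : exists (B C : R) (a : I -> 'M[R]_(d, n) -> word -> R),
  [/\ 0 < B, 0 <= C, forall pq c w, cube c -> `|a pq c w| <= B &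
   forall pq c X h, cube c -> cube X -> 0 <= h <= 1 ->
     (forall i j, `|X i j - c i j| <= h) ->
     `|f X pq.1 pq.2 - \sum_w a pq c w * word_mon w X| <= C * h `^ gam].
Proof.
have /fin_all_exists[B /fin_all_exists[C h]] :=
  fun pq : I => holder_local_poly lam_gt0 (f_holder pq.1 pq.2).
have B0 pq : 0 <= B pq by case: (h pq).
have C0 pq : 0 <= C pq by case: (h pq).
have key (x : I * 'M[R]_(d, n)) : exists a : word -> R, cube x.2 ->
    (forall w, `|a w| <= B x.1) /\ forall X t, cube X -> 0 <= t <= 1 ->
     (forall i j, `|X i j - x.2 i j| <= t) ->
     `|f X x.1.1 x.1.2 - \sum_w a w * word_mon w X| <= C x.1 * t `^ gam.
  (* Centres outside the cube get zero coefficients, so that [choice] can range over all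
     matrices. *)
  case: (pselect (cube x.2)) => [hx|]; last by exists (fun=> 0).
  have [_ _ /(_ _ hx)[g [a ha hg] hf]] := h x.1.
  by exists a => _; split=> // X t hX ht hXt; rewrite -hg; apply: hf.
have [a ha] := choice key.
exists (1 + \sum_pq B pq), (\sum_pq C pq), (fun pq c => a (pq, c)); split.
- by rewrite ltr_pwDl // sumr_ge0.
- exact: sumr_ge0.
- move=> pq c w hc; have [h1 _] := ha (pq, c) hc; apply: le_trans (h1 w) _.
  by apply: le_trans (ler_sum_term _ B0) _; rewrite lerDr.
- move=> pq c X t hc hX ht hXt; have [_ h2] := ha (pq, c) hc.
  apply: le_trans (h2 X t hX ht hXt) _.
  by rewrite ler_wpM2r ?powR_ge0 // (ler_sum_term _ C0).
Qed.

Lemma last_block a : (#|token_idx| <= a)%N -> exists C : R, 0 < C /\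
  forall eps : R, 0 < eps < 1 -> exists (W : nat) (g : fnn R a d W),
  [/\ (fnn_depth g)%:R <= C * (1 + ln (eps^-1)),
      W%:R <= C * eps `^ (- ((d * n)%:R / gam)),
      (fnn_nparams g)%:R <= C * eps `^ (- ((d * n)%:R / gam)),
      fnn_bnd g (C * eps `^ (- Num.max ((6 * d * n + 2)%:R / gam) (1 / lam))) &
      forall X q p, cube X ->
        `|fnn_eval g (emb a (token_state (X, q))) p 0 - f X p q| <= eps].
Proof.
move=> ha.
have [B [C [co [B0 C0 co_bnd co_approx]]]] := uniform_local_poly.
have gam0 : 0 < gam by rewrite ltr_wpDl.
have m0 : (0 < d * n)%N by rewrite muln_gt0 d_gt0.
have hdn : ((d * n).+1 <= 6 * d * n + 2)%N by rewrite -mulnA; lia.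
have cI : #|{: I}| = (d * n)%N by rewrite card_prod !card_ord.
pose T := term d n s.
pose ell := (1 + d * n + s)%N.
(* Half of [eps] is for the Taylor error and half for the products; the added 1 makes [A] and [Z]
   positive. *)
pose A := 2 * C + 1.
pose Z := 2 * (#|T|%:R * B * ell%:R) + 1.
have TB0 : 0 <= #|T|%:R * B by rewrite mulr_ge0 // ltW.
have A0 : 0 < A by rewrite /A; lra.
have Tl0 : 0 <= #|T|%:R * B * ell%:R by rewrite mulr_ge0.
have Z0 : 0 < Z by rewrite /Z; lra.
have [c [c0 hc]] := rates gam0 m0 A0 Z0.
pose D := (#|token_idx| + #|raw_idx I 'I_n| + #|{: I}| + #|feat_idx I 'I_n| + #|{ffun I -> bool}|
  + #|T| + mul_card (feat_idx I 'I_n) T + #|'I_d| + 1)%N.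
pose Q := (40 * D * D + ell * (2 * D * D) + ell + 5 + 6 * D + (2 * (d * n) + 9) + 1)%N.
exists (Q%:R * c + #|T|%:R * B + Q%:R).
set CC := (X in 0 < X /\ _).
have Qc0 : 0 <= Q%:R * c by rewrite mulr_ge0 // ltW.
have [Q4 Q1 Q2 Q3 [Q5 Q0]] := leq_summands6 (40 * D * D + ell * (2 * D * D)) ell 5
  (6 * D) (2 * (d * n) + 9) 1.
rewrite -/Q in Q0 Q1 Q2 Q3 Q4 Q5.
clearbody Q.
have CC0 : 0 < CC by rewrite /CC ltr_wpDl ?ltr0n ?addr_ge0.
split=> // eps heps; have [e0 e1] := andP heps.
have [K [r [K0 [r1 r2 r3 r4 [r5 r6]]]]] := hc eps heps.
pose W := (6 * D * (ncell I K).+1)%N.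
have x_itv (y : 'M[R]_(d, n) * 'I_n) i : in_cube y -> 0 <= coords y i <= 1.
  by move=> h; apply: h.
have o_itv (y : 'M[R]_(d, n) * 'I_n) q : in_cube y -> 0 <= position y q <= 1.
  by move=> _; rewrite /position; case: eqP; rewrite lexx ler01.
have I0 : (0 < #|{: I}|)%N by rewrite cI.
have tc := term_coef_itv B0 co_bnd K0.
have hx i : affine_in (@in_cube R d n) token_state 1 (fun y => coords y i).
  exact: (affine_in_coord _ token_state (inl (inr i))).
have ho q : affine_in (@in_cube R d n) token_state 1 (fun y => position y q).
  exact: (affine_in_coord _ token_state (inr q)).
pose M := memo_bnd R I K + #|T|%:R * B.
have oc p (t : T) : `|out_coef B p t| <= B.
  rewrite /out_coef; case: ifP => _; last by rewrite normr0 ltW.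
  by rewrite normrMsign gtr0_norm.
have hco (p : 'I_d) : \sum_(t : T) `|out_coef B p t| <= M.
  apply: (@le_trans _ _ (#|T|%:R * B)); last by rewrite lerDr ler0n.
  exact: sum_le_card.
have hM : memo_bnd R I K <= M by rewrite lerDl.
have [g [g1 g2 g3 g4]] := memo_net x_itv o_itv (fun t : T => t.2.1) K0 I0 tc
  (term_factors d n s) d r ha (leqnn W) hM hco hx ho.
have {}g2 : (fnn_nparams g <= 40 * D * D * (ncell I K).+1 + ell * r.+2 * (2 * D * D))%N.
  by rewrite /ell -(size_term_factors d n s).
have {}g1 : fnn_depth g = (ell * r.+2 + 5)%N by rewrite g1 size_term_factors.
exists W, g.
have NE : (ncell I K).+1 = (K.+1 ^ (d * n))%N by rewrite ncellS cI.
have E0 : 0 <= eps `^ (- ((d * n)%:R / gam)) by apply: powR_ge0.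
have L0 : 0 <= ln eps^-1 by rewrite ln_ge0 // invf_ge1 // ltW.
have NB (q : nat) : (q <= Q)%N ->
    (q * (ncell I K).+1)%:R <= CC * eps `^ (- ((d * n)%:R / gam)).
  move=> qQ; rewrite natrM NE; apply: (@le_trans _ _ (q%:R * (c * eps `^ (- ((d * n)%:R / gam))))).
    by rewrite ler_wpM2l.
  rewrite mulrA ler_wpM2r // /CC -addrA ler_wpDr ?addr_ge0 // ler_wpM2r ?ler_nat //.
  exact: ltW.
have cQ (q : nat) : (q <= Q)%N -> q%:R * c <= Q%:R * c.
  by move=> qQ; rewrite ler_wpM2r ?ler_nat // ltW.
have L1 : 0 <= 1 + ln eps^-1 by rewrite addr_ge0.
split.
- rewrite g1 natrD natrM.
  have h1 : ell%:R * r.+2%:R <= ell%:R * (c * (1 + ln eps^-1)) by rewrite ler_wpM2l.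
  have h2 : 5 * 1 <= Q%:R * (1 + ln eps^-1).
    by apply: ler_pM; rewrite ?(ler_nat R 5) ?lerDl.
  have h3 := ler_wpM2r L1 (cQ _ Q1).
  have h4 := mulr_ge0 TB0 L1.
  by rewrite /CC !mulrDl -mulrA in h3 *; lra.
- by rewrite /W; apply: NB.
- apply: (@le_trans _ _ (40 * D * D * (ncell I K).+1 + ell * r.+2 * (2 * D * D))%:R).
    by rewrite ler_nat.
  rewrite natrD natrM mulnAC [(_ * r.+2)%:R]natrM NE.
  set E := eps `^ _ in r3 r6 E0 *.
  have h1 : (40 * D * D)%:R * (K.+1 ^ (d * n))%:R <= (40 * D * D)%:R * (c * E).
    by rewrite ler_wpM2l.
  have h2 : (ell * (2 * D * D))%:R * r.+2%:R <= (ell * (2 * D * D))%:R * (c * E).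
    by rewrite ler_wpM2l.
  have h3 := ler_wpM2r E0 (cQ _ Q4).
  have h4 := mulr_ge0 TB0 E0; have h5 : 0 <= Q%:R * E by rewrite mulr_ge0.
  by rewrite natrD in h3; rewrite /CC !mulrDl -?mulrA in h1 h2 h3 h4 *; lra.
- apply: fnn_bnd_mono g3; set X := eps `^ _.
  have X1 : 1 <= X.
    rewrite /X -[leLHS](powRr0 eps) ger_powR ?e0 ?(ltW e1) // oppr_le0.
    by rewrite le_max divr_ge0 // ltW.
  (* The weights grow like [K^(m + 1)] with [m = d * n], and [m + 1 <= 6 * m + 2]. *)
  have EX : eps `^ (- ((d * n).+1%:R / gam)) <= X.
    rewrite ger_powR ?e0 ?(ltW e1) // lerN2 le_max ler_wpM2r ?invr_ge0 ?(ltW gam0) //.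
    by rewrite ler_nat.
  have X0 : 0 <= X by apply: le_trans X1.
  rewrite /M /memo_bnd NE cI -mulnA natrM.
  have h1 : (2 * (d * n) + 9)%:R * (K.+1 * K.+1 ^ (d * n))%:R <=
      (2 * (d * n) + 9)%:R * (c * X).
    by rewrite ler_wpM2l // (le_trans r4) // ler_wpM2l // ltW.
  have h2 := ler_wpM2r X0 (cQ _ Q5).
  have h3 : #|T|%:R * B * 1 <= #|T|%:R * B * X by rewrite ler_wpM2l.
  have h4 : 0 <= Q%:R * X by rewrite mulr_ge0.
  by rewrite /CC !mulrDl -?mulrA in h1 h2 h3 h4 *; lra.
- move=> X q p hX; rewrite g4 // emb_ord.
  have e2 := approximant_error d_gt0 n_gt0 B0 co_approx K0 q p hX.
  set o := \sum_t _.
  (* The two sums differ only in their products, each with [ell] multiplications. *)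
  have e3 : `|o - approximant B co K (X, q) p| <= #|T|%:R * B * ell%:R * 4^-1 ^+ r.
    rewrite /o /approximant -sumrB (le_trans (ler_norm_sum _ _ _)) //.
    rewrite -!mulrA; apply: sum_le_card => t.
    rewrite -mulrBr normrM ler_pM ?oc //.
    have hy : in_cube (X, q) by [].
    have hm := memo_itv x_itv (fun t : T => t.2.1) K0 I0 tc t hy.
    have [|_ h] := prodapxP r hm (fs := [seq feat (@coords R d n) (@position R d n) K (X, q) (sel t)
       | sel : T -> feat_idx I 'I_n <- term_factors d n s]).
      by move=> v /mapP[sel _ ->]; apply: (feat_itv x_itv o_itv K0).
    by move: h; rewrite size_map size_term_factors big_map.
  have -> : o - f X p q = (o - approximant B co K (X, q) p) +
     (approximant B co K (X, q) p - f X p q) by rewrite addrA subrK.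
  rewrite (le_trans (ler_normD _ _)) //.
  have q0 : 0 <= (4^-1 : R) ^+ r by rewrite exprn_ge0 ?invr_ge0.
  have k0 : 0 <= (K%:R^-1 : R) `^ gam by apply: powR_ge0.
  move: r1 r2 e2 e3 q0 k0; rewrite /A /Z.
  move: (4^-1 ^+ r) (K%:R^-1 `^ gam) (#|T|%:R * B * ell%:R) => u v w r1 r2 e2 e3 u0 v0.
  lra.
Qed.

End LastBlock.

(** * Routing by attention *)


Lemma relu_path_id (R : realType) (Y : Type) (dom : Y -> Prop) (A : finType)
    (F : Y -> A -> R) W k : (#|A| <= W)%N -> (forall y a, dom y -> 0 <= F y a) ->
  relu_path dom W k (k * (#|A| * #|A|.+1)) 1 F F.
Proof.
move=> hW F0; elim: k => [|k IH]; first exact: relu_path_nil.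
rewrite mulSn -add1n; apply: relu_path_cat IH; apply: relu_path_layer => // a.
exact: (carry_relu (lexx 1) (fun y dy => F0 y a dy) (fun y => erefl (F y a))).
Qed.

Lemma col_ff_block (R : realType) a b W (g : fnn R a b W) n (X : 'M[R]_(a, n)) q :
  col q (ff_block g X) = fnn_eval g (col q X).
Proof. by apply/matrixP => i j; rewrite !mxE !ord1. Qed.

Lemma col_mulmx (R : realType) m p q (A : 'M[R]_(m, p)) (B : 'M[R]_(p, q)) j :
  col j (A *m B) = A *m col j B.
Proof. by rewrite !colE mulmxA. Qed.

Lemma softmaxC0 (R : realType) m p : softmaxC (0 : 'M[R]_(m, p)) = const_mx (m%:R^-1).
Proof.
apply/matrixP => i j; rewrite !mxE expR0 mul1r; congr (_^-1).
under eq_bigr do rewrite mxE expR0.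
by rewrite sumr_const card_ord.
Qed.

Section Routing.
Variables (R : realType) (d n : nat).
Local Notation I := ('I_d * 'I_n)%type.
Local Notation mx := 'M[R]_(d, n).
Local Notation tok := (token_idx d n).

Definition embed_idx : finType := ('I_d + 'I_n)%type.

Definition embed_state (y : mx * 'I_n) (e : embed_idx) : R :=
  match e with inl i => y.1 i y.2 | inr j => (y.2 == j)%:R end.

(** [token_state] before attention: the slots for the whole input are kept at 0, because the
    residual connection adds the gathered entries to them. *)
Definition scatter_state (y : mx * 'I_n) (e : tok) : R :=
  match e with
  | inl (inl i) => if i.2 == y.2 then y.1 i.1 i.2 else 0
  | inl (inr i) => 0
  | inr q => (y.2 == q)%:R
  end.

Definition embed_weight D : 'M[R]_(D, d) :=
  embM d D (fun (e : embed_idx) i => if e is inl i' then (i' == i)%:R else 0).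

Definition embed_bias D : 'M[R]_(D, n) :=
  \matrix_(i, q) emb D (fun e : embed_idx => if e is inr j then (q == j)%:R else 0) i 0.

Lemma embedE D (X : mx) q :
  col q (embed_weight D *m X + embed_bias D) = emb D (embed_state (X, q)).
Proof.
have -> : col q (embed_weight D *m X + embed_bias D) =
    embed_weight D *m emb d (X ^~ q) +
    emb D (fun e : embed_idx => if e is inr j then (q == j)%:R else 0).
  rewrite linearD /= col_mulmx; congr (_ *m _ + _); apply/matrixP => i j.
    by rewrite !ord1 emb_ord mxE.
  by rewrite !ord1 2!mxE.
rewrite embM_mul ?card_ord // embD; congr emb; apply: funext => -[i|j] /=.
  rewrite addr0 (bigD1 i) //= eqxx mul1r big1 ?addr0 // => k /negbTE.
  by rewrite eq_sym => ->; rewrite mul0r.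
by rewrite big1 ?add0r // => k _; rewrite mul0r.
Qed.

Lemma embed_bnd D : mx_bnd (embed_weight D) 1 /\ mx_bnd (embed_bias D) 1.
Proof.
have b01 (b : bool) : `|b%:R : R| <= 1 by case: b; rewrite ?normr1 ?normr0.
split; first by apply: embM_bnd => // -[i|j] a //; rewrite normr0.
move=> i q; rewrite mxE; apply: emb_bnd => // -[a|j] //.
by rewrite normr0.
Qed.

Lemma scatter_block a b W : (#|embed_idx| <= a)%N -> (#|tok| <= W)%N ->
  exists g : fnn R a b W, [/\ fnn_depth g = 4%N,
    (fnn_nparams g <= 4 * #|tok| * (#|tok| + #|embed_idx| + 1))%N, fnn_bnd g 3 &
    forall X q, cube X -> fnn_eval g (emb a (embed_state (X, q))) = emb b (scatter_state (X, q))].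
Proof.
move=> ha hW.
have s0 (y : mx * 'I_n) e : cube y.1 -> 0 <= scatter_state y e.
  move=> hy; case: e => [[i|i]|j] //=; case: ifP => // _.
  by have /andP[] := hy i.1 i.2.
have le13 : 1 <= 3 :> R by rewrite ler1n.
(* Two identity layers, exact on the nonnegative state, pad the block to depth 4. *)
have p := relu_path_mono (leqnn _) le13 (relu_path_id (dom := fun y => cube y.1) 2 hW s0).
have hk e : exists2 g, affine_in (fun y => cube y.1) embed_state 3 g &
    forall y, cube y.1 -> scatter_state y e = Num.max (g y) 0.
  have aE := affine_in_coord (fun y : mx * 'I_n => cube y.1) embed_state.
  case: e => [[i|i]|q].
  - exists (fun y => embed_state y (inl i.1) + embed_state y (inr i.2) - 1).
      have := affine_inB (affine_inD (aE (inl i.1)) (aE (inr i.2))) (affine_in_const _ _ 1).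
      by rewrite normr1; apply: affine_in_mono; lra.
    move=> y hy /=; rewrite [i.2 == _]eq_sym; case: eqP => [<-|_].
      by rewrite addrK; have /andP[/max_idPl -> _] := hy i.1 y.2.
    have /andP[_ h] := hy i.1 y.2.
    by have /max_idPr -> : y.1 i.1 y.2 + 0 - 1 <= 0 by lra.
  - exists (fun=> 0); last by move=> y _; rewrite /= maxxx.
    by have := affine_in_const (fun y : mx * 'I_n => cube y.1) embed_state 0; rewrite normr0;
      apply: affine_in_mono.
  - exists (fun y => embed_state y (inr q)); first exact: affine_in_mono le13 (aE _).
    by move=> y _ /=; have /max_idPl -> := ler0n R (y.2 == q).
have [g [g1 g2 g3 g4]] := fnn_of_path b (ler0n R 3) ha hW hk p
   (fun e => affine_in_mono le13 (affine_in_coord _ _ e)).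
exists g; split=> //; first by apply: leq_trans g2 _; nia.
by move=> X q hX; apply: g4.
Qed.

Lemma identity_block a b W : (#|tok| <= a)%N -> (#|tok| <= W)%N ->
  exists g : fnn R a b W, [/\ fnn_depth g = 3%N,
    (fnn_nparams g <= 4 * #|tok| * (#|tok| + #|embed_idx| + 1))%N, fnn_bnd g 3 &
    forall (X : mx) q, cube X -> fnn_eval g (emb a (token_state (X, q))) = emb b (token_state (X, q))].
Proof.
move=> ha hW.
have s0 (y : mx * 'I_n) (e : tok) : cube y.1 -> 0 <= token_state y e.
  move=> hy; case: e => [[i|i]|j] //=.
    by case: ifP => // _; have /andP[] := hy i.1 i.2.
  by have /andP[] := hy i.1 i.2.
have le13 : 1 <= 3 :> R by rewrite ler1n.
have p := relu_path_mono (leqnn _) le13 (relu_path_id (dom := fun y => cube y.1) 1 hW s0).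
have hk e : exists2 g, affine_in (fun y => cube y.1) (@token_state R d n) 3 g &
    forall y, cube y.1 -> token_state y e = Num.max (g y) 0.
  exact: (carry_relu le13 (fun y dy => s0 y e dy) (fun y => erefl (token_state y e))).
have [g [g1 g2 g3 g4]] := fnn_of_path b (ler0n R 3) ha hW hk p
   (fun e => affine_in_mono le13 (affine_in_coord _ _ e)).
exists g; split=> //; first by apply: leq_trans g2 _; nia.
by move=> X q hX; apply: g4.
Qed.

(* Zero query and key matrices make the softmax uniform, so the single active
   head adds up the scattered entries of all tokens exactly. *)
Definition gather_WO D S : 'M[R]_(D, S) :=
  embM S D (fun (e : tok) (i : I) => if e is inl (inr i') then n%:R * (i' == i)%:R else 0).

Definition gather_WV D S : 'M[R]_(S, D) :=
  embM D S (fun (i : I) (e : tok) => if e is inl (inl i') then (i' == i)%:R else 0).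

(** The number of heads is prescribed; spare heads are zero, and with no active head the residual
    connection is the identity. *)
Definition attention (active : bool) D S H : sa_layer R D S H :=
  SAL (fun h : 'I_H => if active && (h == 0 :> nat)%N then gather_WO D S else 0)
      (fun h : 'I_H => if active && (h == 0 :> nat)%N then gather_WV D S else 0)
      (fun=> 0) (fun=> 0).

Lemma attention_idle D S H (X : 'M[R]_(D, n)) : sa_apply (attention false D S H) X = X.
Proof. by rewrite /sa_apply big1 ?addr0 // => h _; rewrite /= !mul0mx. Qed.

Hypothesis n_gt0 : (0 < n)%N.

Lemma attention_bnd active D S H : sa_bnd (attention active D S H) n%:R.
Proof.
have b01 (b : bool) : `|b%:R : R| <= 1 by case: b; rewrite ?normr1 ?normr0.
have n1 : 1 <= n%:R :> R by rewrite ler1n.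
have z m p : mx_bnd (0 : 'M[R]_(m, p)) n%:R by move=> i j; rewrite mxE normr0.
move=> h /=; case: ifP => _; do 2?split=> //.
- apply: embM_bnd => // -[[i|i]|q] j; rewrite ?normr0 //.
  by rewrite normrM ger0_norm // ler_piMr.
- apply: embM_bnd => // i -[[j|j]|q]; rewrite ?normr0 //.
  exact: le_trans n1.
Qed.

(** Entry [i] of the input is scattered in token [i.2] and is 0 in all others, so the sum over
    tokens recovers it; the factor [n] in [gather_WO] undoes the average. *)
Lemma attention_gather D S H (X : mx) (Z : 'M[R]_(D, n)) q :
  (#|tok| <= D)%N -> (d * n <= S)%N -> (0 < H)%N ->
  (forall q, col q Z = emb D (scatter_state (X, q))) ->
  col q (sa_apply (attention true D S H) Z) = emb D (token_state (X, q)).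
Proof.
move=> hD hS H0 hZ.
have hI : (#|{: I}| <= S)%N by rewrite card_prod !card_ord.
rewrite /sa_apply (bigD1 (Ordinal H0)) //= [X in Z + (_ + X)]big1 ?addr0; last first.
  by move=> h /negbTE; rewrite -val_eqE /= => ->; rewrite !mul0mx.
rewrite trmx0 mulmx0 !mul0mx softmaxC0 linearD /= hZ.
have -> : col q (gather_WO D S *m gather_WV D S *m Z *m const_mx n%:R^-1) =
   gather_WO D S *m (gather_WV D S *m emb D (fun e => n%:R^-1 * \sum_j scatter_state (X, j) e)).
  rewrite col_mulmx -!mulmxA; do 2 congr (_ *m _).
  rewrite -embZ -emb_sum; under [in RHS]eq_bigr do rewrite -hZ.
  apply/matrixP => i j; rewrite !mxE summxE mulr_sumr; apply: eq_bigr => k _.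
  by rewrite !mxE mulrC.
rewrite !embM_mul // embD; congr emb; apply: funext => -[[i|i]|j] /=.
- by rewrite big1 ?addr0 // => k _; rewrite mul0r.
- rewrite add0r (bigD1 i) //= eqxx mulr1 [X in _ + X]big1 ?addr0; last first.
    by move=> k /negbTE; rewrite eq_sym => ->; rewrite mulr0 mul0r.
  rewrite (bigD1 (inl (inl i))) //= eqxx mul1r [X in _ + X]big1 ?addr0; last first.
    move=> [[k|k]|k] ne; rewrite ?mul0r //; case: eqP => [e|_]; last by rewrite mul0r.
    by case/eqP: ne; rewrite e.
  rewrite mulrA mulfV ?mul1r ?pnatr_eq0 -?lt0n // (bigD1 i.2) //= eqxx.
  by rewrite big1 ?addr0 // => k /negbTE; rewrite eq_sym => ->.
- by rewrite big1 ?addr0 // => k _; rewrite mul0r.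
Qed.

End Routing.

(** * Assembly *)


Section Assembly.
Variables (R : realType) (d n s : nat).
Hypothesis d_gt0 : (0 < d)%N.
Hypothesis n_gt0 : (0 < n)%N.
Local Notation mx := 'M[R]_(d, n).
Local Notation D := (thm_dims d n s).
Local Notation tok := (token_idx d n).

Definition head_dim (k : nat) : nat := if k == 1%N then maxn (d * n) 3 else 3.

Definition head_count (k : nat) : nat :=
  if k == 1%N then ((3 * d + 1) * 3 ^ (d * n) * binom_sdn d n s)%N
  else (d * 3 ^ (d * n + 1) * binom_sdn d n s)%N.

(** The first block has constant width, which is within the growth allowed to it. *)
Definition ff_width (Wn k : nat) : nat :=
  if k == n then Wn else if k == 0%N then #|tok|
  else (d * 3 ^ (d * n) * binom_sdn d n s * (4 * n + 11))%N.

Let cardT : #|tok| = (2 * d * n + n)%N.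
Proof. by rewrite !card_sum !card_prod !card_ord; lia. Qed.

Let pos3 : (3 <= 3 ^ (d * n))%N.
Proof. by rewrite -{1}(expn1 3) leq_exp2l // muln_gt0 d_gt0. Qed.

Let posb : (0 < binom_sdn d n s)%N.
Proof. by rewrite /binom_sdn bin_gt0; lia. Qed.

Lemma tok_dims k : (#|tok| <= D k.+1)%N.
Proof.
rewrite cardT /thm_dims /=; apply: (@leq_trans ((2 * d * n + 5 * d) * 3)).
  by have := leq_pmull n d_gt0; lia.
by rewrite -[leqLHS]muln1 leq_mul // leq_mul.
Qed.

Lemma tok_width Wn k : k != n -> (#|tok| <= ff_width Wn k)%N.
Proof.
move=> /negbTE kn; rewrite /ff_width kn; case: eqP => // _; rewrite cardT.
apply: (@leq_trans (d * 1 * 1 * (4 * n + 11))%N).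
  by have := leq_pmull n d_gt0; nia.
by rewrite leq_mul // leq_mul // leq_mul // (leq_trans _ pos3).
Qed.

Definition block_params : nat := (4 * #|tok| * (#|tok| + #|embed_idx d n| + 1))%N.

Definition attention_params : nat :=
  (\sum_(1 <= k < n.+1) head_count k * (4 * (D k * head_dim k)))%N.

Lemma routing_blocks Wn : exists ff : forall k, fnn R (D k) (D k.+1) (ff_width Wn k),
  forall k, (k < n)%N ->
  [/\ fnn_depth (ff k) = (if k == 0 then 4 else 3)%N,
    (fnn_nparams (ff k) <= block_params)%N, fnn_bnd (ff k) 3 &
    forall (X : mx) q, cube X ->
      if k == 0%N then fnn_eval (ff k) (emb (D k) (embed_state (X, q))) =
                       emb (D k.+1) (scatter_state (X, q))
      else fnn_eval (ff k) (emb (D k) (token_state (X, q))) =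
                       emb (D k.+1) (token_state (X, q))].
Proof.
(* The type of a block depends on [k], so the blocks are selected through a sigma type. *)
suff h k : {g : fnn R (D k) (D k.+1) (ff_width Wn k) | (k < n)%N ->
  [/\ fnn_depth g = (if k == 0 then 4 else 3)%N,
    (fnn_nparams g <= block_params)%N, fnn_bnd g 3 &
    forall (X : mx) q, cube X ->
      if k == 0%N then fnn_eval g (emb (D k) (embed_state (X, q))) =
                       emb (D k.+1) (scatter_state (X, q))
      else fnn_eval g (emb (D k) (token_state (X, q))) =
                       emb (D k.+1) (token_state (X, q))]}.
  by exists (fun k => sval (h k)) => k; case: (h k).
apply: cid; case: (ltnP k n) => kn; last first.
  (* The zero network is the default, as [transformer] asks for a block at every [k]. *)
  by exists (FNN 0 0 [::] 0 0).
have kW := tok_width Wn (negbT (ltn_eqF kn)).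
case: k kn kW => [|k] kn kW /=.
  have [|g hg] := @scatter_block R d n (D 0) (D 1) _ _ kW; last by exists g.
  by rewrite card_sum !card_ord /thm_dims /=; lia.
by have [g hg] := @identity_block R d n (D k.+1) (D k.+2) _ (tok_dims k) kW; exists g.
Qed.

Section Network.
Variables (Wn : nat) (ff : forall k, fnn R (D k) (D k.+1) (ff_width Wn k)).
Variable g : fnn R (D n) d (ff_width Wn n).

Definition network : transformer R n d d n D (ff_width Wn) head_dim head_count :=
  TF (embed_weight R d n (D 0)) (embed_bias R d n (D 0)) ff g
     (fun k => attention R d n (k == 1%N) (D k) (head_dim k) (head_count k)).

Hypothesis ff_spec : forall k (X : mx) q, (k < n)%N -> cube X ->
      if k == 0%N then fnn_eval (ff k) (emb (D k) (embed_state (X, q))) =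
                       emb (D k.+1) (scatter_state (X, q))
      else fnn_eval (ff k) (emb (D k) (token_state (X, q))) =
                       emb (D k.+1) (token_state (X, q)).

Lemma network_tokens k (X : mx) q : (k < n)%N -> cube X ->
  col q (tf_pre network (tf_run network X k.+1)) = emb (D k.+1) (token_state (X, q)).
Proof.
move=> kn hX; elim: k kn q => [|k IH] kn q.
  apply: attention_gather => //.
  - exact: tok_dims.
  - by rewrite /head_dim /= leq_maxl.
  - by rewrite /head_count /= !muln_gt0 expn_gt0 posb addn_gt0 orbT.
  - by move=> q'; rewrite /= col_ff_block embedE (ff_spec (k := 0)).
rewrite [tf_pre _ _]attention_idle [tf_run _ _ _]/= col_ff_block.
by rewrite IH 1?ltnW // (ff_spec (k := k.+1)).
Qed.

Lemma network_eval (X : mx) p q : cube X ->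
  tf_eval network X p q = fnn_eval g (emb (D n) (token_state (X, q))) p 0.
Proof.
move=> hX; rewrite /tf_eval mxE.
have key m : (0 < m <= n)%N ->
    col q (tf_pre network (tf_run network X m)) = emb (D m) (token_state (X, q)).
  by case: m => // m /andP[_ h]; apply: network_tokens.
by rewrite key // n_gt0 leqnn.
Qed.

End Network.
End Assembly.

Theorem theorem2 (R : realType) (d n s : nat) (lam : R) :
  (0 < d)%N -> (0 < n)%N -> 0 < lam -> lam <= 1 ->
  forall f : 'M[R]_(d, n) -> 'M[R]_(d, n),
  (forall (p : 'I_d) (q : 'I_n), holder s lam (fun x => f x p q)) ->
  let gam := s%:R + lam in
  exists C : R, 0 < C /\
  forall eps : R, 0 < eps < 1 ->
  exists (Wd Sd Hd : nat -> nat)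
         (T : transformer R n d d n (thm_dims d n s) Wd Sd Hd),
    (* size *)
    [/\ tf_depth T 0 = 4%N /\
        (Wd 0%N)%:R <= C * eps `^ (- (1 / gam)),
        (Hd 1%N = (3 * d + 1) * 3 ^ (d * n) * binom_sdn d n s)%N /\
          Sd 1%N = maxn (d * n) 3,
        (forall l, (1 <= l <= n - 1)%N ->
           tf_depth T l = 3%N /\
           Wd l = (d * 3 ^ (d * n) * binom_sdn d n s * (4 * n + 11))%N),
        (forall l, (2 <= l <= n)%N ->
           Hd l = (d * 3 ^ (d * n + 1) * binom_sdn d n s)%N /\ Sd l = 3%N) &
        (tf_depth T n)%:R <= C * (1 + ln (eps^-1)) /\
        (Wd n)%:R <= C * eps `^ (- ((d * n)%:R / gam))]
    (* approximation *)
    /\ (forall (X : 'M[R]_(d, n)), cube X -> forall p q,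
          `| tf_eval T X p q - f X p q | <= eps)
    (* weight bounds *)
    /\ [/\ tf_bnd_EB T C,
           tf_bnd_FF T (C * eps `^ (- Num.max ((6 * d * n + 2)%:R / gam) (1 / lam))) &
           tf_bnd_SA T (C * (1 + ln (eps^-1)))]
    (* numbers of parameters *)
    /\ [/\ (tf_M_EB T)%:R <= C,
           (tf_M_FF T)%:R <= C * eps `^ (- ((d * n)%:R / gam)) &
           (tf_M_SA T)%:R <= C].
Proof.
move=> d_gt0 n_gt0 lam_gt0 _ f f_holder gam.
have tokn : (#|token_idx d n| <= thm_dims d n s n)%N.
  by case: n n_gt0 f f_holder => // n' _ _ _; apply: tok_dims.
have [C0 [C0_gt0 last]] := last_block d_gt0 n_gt0 lam_gt0 f_holder tokn.
pose EB := (thm_dims d n s 0 * d + thm_dims d n s 0 * n)%N.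
pose Q := (3 + n + #|token_idx d n| + EB + n * block_params d n + attention_params d n s)%N.
have [Q1 Q2 Q3 Q4 [Q5 Q6]] := leq_summands6 3 n #|token_idx d n| EB
  (n * block_params d n) (attention_params d n s).
rewrite -/Q in Q1 Q2 Q3 Q4 Q5 Q6; clearbody Q.
exists (C0 + Q%:R).
have C_gt0 : 0 < C0 + Q%:R by rewrite ltr_wpDr.
split=> // eps heps; have [e0 e1] := andP heps.
have gam0 : 0 < gam by rewrite ltr_wpDl.
have [W [g0 hg0]] := last eps heps.
have nn : (n == 0%N) = false by rewrite eqn0Ngt n_gt0.
(* [ff_width d n s W n] equals [W] only after rewriting, so the block is transported before it is
   named. *)
have [g hg] : exists g : fnn R (thm_dims d n s n) d (ff_width d n s W n),
  [/\ (fnn_depth g)%:R <= C0 * (1 + ln (eps^-1)),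
      (ff_width d n s W n)%:R <= C0 * eps `^ (- ((d * n)%:R / gam)),
      (fnn_nparams g)%:R <= C0 * eps `^ (- ((d * n)%:R / gam)),
      fnn_bnd g (C0 * eps `^ (- Num.max ((6 * d * n + 2)%:R / gam) (1 / lam))) &
      forall X q p, cube X ->
        `|fnn_eval g (emb (thm_dims d n s n) (token_state (X, q))) p 0 - f X p q| <= eps].
  by rewrite /ff_width eqxx; exists g0.
have [g1 g2 g3 g4 g5] := hg.
have [ff hff] := routing_blocks R s d_gt0 n_gt0 W.
have pow1 (x : R) : 0 <= x -> 1 <= eps `^ (- x).
  by move=> x0; rewrite -[leLHS](powRr0 eps) ger_powR ?e0 ?(ltW e1) // oppr_le0.
have E1 : 1 <= eps `^ (- (1 / gam)) by apply: pow1; rewrite divr_ge0 // ltW.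
have Em : 1 <= eps `^ (- ((d * n)%:R / gam)) by apply: pow1; rewrite divr_ge0 // ltW.
have Ew : 1 <= eps `^ (- Num.max ((6 * d * n + 2)%:R / gam) (1 / lam)).
  by apply: pow1; rewrite le_max divr_ge0 // ltW.
have L1 : 1 <= 1 + ln eps^-1 by rewrite lerDl ln_ge0 // invf_ge1 // ltW.
(* For [eps < 1] every rate is at least 1, so quantities independent of [eps] are absorbed into the
   constant. *)
have const_le (q : nat) (x : R) : (q <= Q)%N -> 1 <= x -> q%:R <= (C0 + Q%:R) * x.
  move=> qQ x1; rewrite -[leLHS]mulr1 ler_pM // (le_trans (_ : _ <= Q%:R)) ?ler_nat //.
  by rewrite lerDr ltW.
have C0_le (x : R) : 1 <= x -> C0 * x <= (C0 + Q%:R) * x.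
  by move=> x1; rewrite ler_wpM2r ?(le_trans ler01) // lerDl.
have constC (q : nat) : (q <= Q)%N -> q%:R <= C0 + Q%:R.
  by move=> qQ; rewrite -[leRHS]mulr1; apply: const_le.
exists (ff_width d n s W), (head_dim d n), (head_count d n s), (network ff g).
split; [split|split; [|split; split]].
- rewrite /tf_depth n_gt0; have [-> _ _ _] := hff 0%N n_gt0; split=> //.
  by rewrite /ff_width eq_sym nn; apply: const_le.
- by [].
- move=> l /andP[l1 l2]; have ln : (l < n)%N by rewrite (leq_ltn_trans l2) // subn1 prednK.
  rewrite /tf_depth ln; have [-> _ _ _] := hff l ln.
  by rewrite /ff_width (ltn_eqF ln) (gtn_eqF l1).
- move=> l /andP[l1 l2]; rewrite /head_count /head_dim (gtn_eqF l1) //.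
- rewrite /tf_depth ltnn; split; first exact: le_trans g1 (C0_le _ L1).
  exact: le_trans g2 (C0_le _ Em).
- move=> X hX p q; rewrite network_eval //; first exact: g5.
  by move=> k X' q' kn hX'; have [_ _ _] := hff k kn; apply.
- have [h1 h2] := embed_bnd R d n (thm_dims d n s 0).
  have C1 : 1 <= C0 + Q%:R by apply: (constC 1%N); apply: leq_trans Q1.
  by split=> i j; apply: le_trans C1.
- split; last exact: fnn_bnd_mono (C0_le _ Ew) g4.
  move=> k kn; have [_ _ h _] := hff k kn; apply: fnn_bnd_mono h.
  exact: (const_le 3%N).
- move=> k _ h; have nC : n%:R <= (C0 + Q%:R) * (1 + ln eps^-1).
    exact: const_le.
  have [h1 [h2 [h3 h4]]] := @attention_bnd R d n n_gt0 (k == 1%N) (thm_dims d n s k)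
    (head_dim d n k) (head_count d n s k) h.
  by do 3?[split; first by move=> i j; apply: le_trans nC]; move=> i j; apply: le_trans nC.
- apply: constC; apply: leq_trans Q4.
  by rewrite leq_add ?nnz_le.
- rewrite /tf_M_FF natrD mulrDl addrC lerD //.
  apply: (@le_trans _ _ (Q%:R * 1)); last by rewrite ler_wpM2l.
  rewrite mulr1 ler_nat; apply: leq_trans Q5.
  rewrite -[X in (_ <= X * _)%N]card_ord -sum_nat_const leq_sum // => k _.
  by have [_ h _ _] := hff k (ltn_ord k).
- apply: constC; apply: leq_trans Q6.
  rewrite /tf_M_SA /attention_params leq_sum // => k _.
  rewrite -[X in (_ <= X * _)%N]card_ord -sum_nat_const leq_sum // => h _.
  set a := (_ * head_dim _ _ _)%N.
  have hb m p (A : 'M[R]_(m, p)) : (m * p = a)%N -> (nnz A <= a)%N by move=> <-; apply: nnz_le.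
  have -> : (4 * a = a + a + a + a)%N by rewrite !mulSn mul0n addn0 !addnA.
  by rewrite !leq_add ?hb // mulnC.
Qed.
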